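(* Let $D_1,\dots,D_n$ be nonsingular hypersurfaces in $\mathbb{P}^n(K)$ intersecting transversally. Then $\mathbb{P}^n(K)\setminus\bigcup_{i=1}^n D_i$ is $K$-hyperbolic if $\deg D_i\ge 2$ for each $1\le i\le n$.
   Context: $K$ is an algebraically closed field of arbitrary characteristic, complete with respect to a non-archimedean absolute value $|\cdot|$. A $K$-analytic function on $K$ is a function given by a power series with coefficients in $K$ converging on all of $K$. An analytic map $f:K\to\mathbb{P}^n(K)$ is a map $f=[f_0:\dots:f_n]$ where $f_0,\dots,f_n$ are $K$-analytic functions on $K$ with no common zero. An analytic map from $K$ to a subset $Y\subset\mathbb{P}^n(K)$ is such a map with image contained in $Y$. A variety $Y$ over $K$ is $K$-hyperbolic if every analytic map from $K$ to $Y$ is constant. Nonsingular hypersurfaces $D_1,\dots,D_n$ in $\mathbb{P}^n(K)$ intersect transversally if for every point $x\in\bigcap_{i=1}^n D_i$ one has $\bigcap_{i=1}^n\Theta_{D_i,x}=\{x\}$, where $\Theta_{D_i,x}$ is the (embedded projective) tangent space to $D_i$ at $x$, a hyperplane of $\mathbb{P}^n(K)$ through $x$. *)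

(* Defs.v *)
From mathcomp Require Import all_boot all_order all_algebra.
From mathcomp Require Import classical_sets reals topology normedtype sequences.
(* The notations of mpoly clash with those of mathcomp-analysis. *)
From mathcomp Require Import -(notations) mpoly.

Set Implicit Arguments.
Unset Strict Implicit.
Unset Printing Implicit Defensive.

Import Order.TTheory GRing.Theory Num.Theory.
Import numFieldNormedType.Exports.

Local Open Scope classical_set_scope.
Local Open Scope ring_scope.

(* The trivial absolute value is allowed. *)
Record nonarch_absval (K : fieldType) (R : realType) := NonarchAbsval {
  absv :> K -> R;
  absv_ge0 : forall x, 0 <= absv x;
  absv_eq0 : forall x, absv x = 0 <-> x = 0;
  absvM : forall x y, absv (x * y) = absv x * absv y;
  absvD_le : forall x y, absv (x + y) <= Num.max (absv x) (absv y)
}.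

Section NonArchimedean.
Variables (K : fieldType) (R : realType) (v : nonarch_absval K R).

Definition absv_cvg (u : nat -> K) (l : K) : Prop :=
  (fun k => v (u k - l)) @ \oo --> (0 : R).

Definition absv_cauchy (u : nat -> K) : Prop :=
  forall e : R, 0 < e ->
    exists N : nat, forall p q : nat, (N <= p)%N -> (N <= q)%N ->
      v (u p - u q) < e.

Definition absv_complete : Prop :=
  forall u : nat -> K, absv_cauchy u -> exists l : K, absv_cvg u l.

Definition analytic (g : K -> K) : Prop :=
  exists a : nat -> K, forall z : K,
    absv_cvg (fun m => \sum_(k < m) a k * z ^+ k) (g z).

End NonArchimedean.

(* The points of P^n(K) are the lines through the origin in K^(n+1), so that
   equality of points is Leibniz equality. *)
Definition proj (K : fieldType) (n : nat) : Type :=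
  {U : {vspace 'rV[K]_n.+1} | \dim U == 1%N}.

Section ProjectiveSpace.
Variables (K : fieldType) (n : nat).

(* vpick selects a nonzero vector of the line.  It is only used below in
   conditions that are homogeneous in the coordinates of each point, hence
   independent of this choice. *)
Definition coords (x : proj K n) : 'I_n.+1 -> K :=
  fun j => vpick (val x) 0 j.

Definition analytic_map (R : realType) (v : nonarch_absval K R)
    (f : K -> proj K n) : Prop :=
  exists F : 'I_n.+1 -> K -> K,
    [/\ forall j, analytic v (F j),
        forall z, exists j, F j z != 0
      & forall z, val (f z) = <[\row_j F j z]>%VS].

Definition hyperbolic (R : realType) (v : nonarch_absval K R)
    (Y : set (proj K n)) : Prop :=
  forall f : K -> proj K n,
    analytic_map v f -> (forall z, Y (f z)) -> forall z w, f z = f w.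

Record hypersurface := Hypersurface {
  hform : mpoly n.+1 K;
  hdeg : nat;
  hdeg_gt0 : (0 < hdeg)%N;
  hform_neq0 : hform != 0;
  hform_homog : hform \is ishomog1 hdeg mdeg
}.

Definition hpoints (D : hypersurface) : set (proj K n) :=
  [set x | meval (coords x) (hform D) = 0].

Definition hpartial (D : hypersurface) (x : proj K n) (j : 'I_n.+1) : K :=
  meval (coords x) (mderiv j (hform D)).

(* For K algebraically closed, this forces hform D to be squarefree,
   so that hform D generates the ideal of the point set hpoints D and
   hdeg D is the degree of the reduced hypersurface. *)
Definition nonsingular (D : hypersurface) : Prop :=
  forall x, hpoints D x -> exists j, hpartial D x j != 0.

Definition tangent_space (D : hypersurface) (x : proj K n) :
    set (proj K n) :=
  [set y | \sum_j hpartial D x j * coords y j = 0].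

Definition intersect_transversally (I : Type) (D : I -> hypersurface) : Prop :=
  forall x, (\bigcap_i hpoints (D i)) x ->
    \bigcap_i tangent_space (D i) x = [set x].

End ProjectiveSpace.

(* Main.v *)
From HB Require Import structures.
Require Import Defs.
From mathcomp Require Import all_boot all_order all_algebra.
From mathcomp Require Import boolp classical_sets reals.
From mathcomp Require Import topology normedtype.
From mathcomp Require Import -(notations) mpoly.
From mathcomp Require Import ring lra zify.

Set Implicit Arguments.
Unset Strict Implicit.
Unset Printing Implicit Defensive.

Import Order.TTheory GRing.Theory Num.Theory.
Import numFieldNormedType.Exports.

Local Open Scope classical_set_scope.
Local Open Scope ring_scope.

(** Let f = [F_0 : ... : F_n] be an analytic map avoiding all the D_i, with
    equations P_i.  Each P_i(F) is an entire function without zeros, hence a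
    nonzero constant c_i: over a complete algebraically closed field a
    nonconstant entire function has a zero ([entire_zero]).  So F is an entire
    parametrization of the affine curve P_i = c_i, and the point is that such
    a curve cannot have a nonconstant one, because of its behaviour at
    infinity.

    When the F_j are polynomials in z, not all constant, this is an expansion
    at z = oo.  The leading coefficients of F form a point p with P_i(p) = 0
    for all i.  Choose X, a multiple of the dominant F_{i0}, so that
    F = X p + H with H_{i0} = 0 and H of smaller growth than X.  If H <> 0, let
    h be the vector of leading coefficients of H.  The leading term of
    c_i = P_i(X p + H) = X^(d-1) (grad P_i(p) . H) + ... gives
    grad P_i(p) . h = 0, because d >= 2 makes X^(d-1) H unbounded and thus too
    big for the constant c_i to interfere.  Then h lies in every tangent space
    at p but is not proportional to p (h_{i0} = 0 <> p_{i0}), which contradicts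
    transversality.  If H = 0 then P_i(F) = X^d P_i(p) = 0, which contradicts
    c_i <> 0; the case n = 0, in which there are no equations, is that of a
    point.

    A transcendental F has no leading coefficients, so a place of the field of
    meromorphic functions plays the part of z = oo.  For every radius r the
    entire functions carry the multiplicative Gauss norm
    M_r(sum_k a_k z^k) = sup_k |a_k| r^k,
    and the meromorphic functions b with M_r(b - c) --> 0 as r --> oo, for
    some constant c, form a ring on which b |-> c is a homomorphism to K
    ([limit_partial_hom]).  Inverses of nonconstant entire functions go to 0
    ([limit_pole]).  As K is algebraically closed, Zorn's lemma extends this
    homomorphism to a valuation ring with residue field K
    ([place_extension]).  Residues with respect to this place replace leading
    coefficients, and the argument above goes through
    ([coordinates_constant]): all that it uses of the entire functions is that
    they form a ring whose nonconstant elements have poles at the place. *)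

(** * Non-archimedean absolute values *)

Section AbsoluteValue.
Variables (K : fieldType) (R : realType) (v : nonarch_absval K R).
Implicit Types (x y : K) (B c : R).

Lemma absv0 : v 0 = 0.
Proof. by have [_ ->] := absv_eq0 v 0. Qed.

Lemma absv_neq0 x : (v x == 0) = (x == 0).
Proof. by apply/eqP/eqP; case: (absv_eq0 v x). Qed.

Lemma absv_gt0 x : (0 < v x) = (x != 0).
Proof. by rewrite lt_neqAle absv_ge0 eq_sym absv_neq0 andbT. Qed.

Lemma absv1 : v 1 = 1.
Proof.
have : v 1 != 0 by rewrite absv_neq0 oner_eq0.
by move=> /mulfI; apply; rewrite -absvM !mulr1.
Qed.

Lemma absvX x n : v (x ^+ n) = v x ^+ n.
Proof. by elim: n => [|n IH]; rewrite ?expr0 ?absv1 // !exprS absvM IH. Qed.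

Lemma absvN x : v (- x) = v x.
Proof.
apply/eqP; rewrite -(@eqrXn2 _ 2) ?absv_ge0 //.
by rewrite -!absvX sqrrN.
Qed.

Lemma absvB_le x y : v (x - y) <= Num.max (v x) (v y).
Proof. by rewrite -[in leRHS](absvN y); exact: absvD_le. Qed.

Lemma absvBC x y : v (x - y) = v (y - x).
Proof. by rewrite -absvN opprB. Qed.

Lemma absvD_eq x y : v y < v x -> v (x + y) = v x.
Proof.
move=> h; apply/le_anti/andP; split.
  by apply: le_trans (absvD_le v x y) _; rewrite ge_max lexx ltW.
have := absvB_le (x + y) y; rewrite addrK le_max => /orP [//|].
by rewrite leNgt h.
Qed.

Lemma absv_sum_le (I : Type) (r : seq I) (P : pred I) (F : I -> K) c B :
  0 <= c -> 0 <= B -> (forall i, P i -> v (F i) * c <= B) ->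
  v (\sum_(i <- r | P i) F i) * c <= B.
Proof.
move=> c0 B0 h; apply: (big_ind (fun x => v x * c <= B)) => //.
  by rewrite absv0 mul0r.
move=> x y hx hy; apply: le_trans (ler_wpM2r c0 (absvD_le v x y)) _.
by rewrite maxr_pMl // ge_max hx.
Qed.

Lemma absv_sum_lt (I : Type) (r : seq I) (P : pred I) (F : I -> K) c B :
  0 <= c -> 0 < B -> (forall i, P i -> v (F i) * c < B) ->
  v (\sum_(i <- r | P i) F i) * c < B.
Proof.
move=> c0 B0 h; apply: (big_ind (fun x => v x * c < B)) => //.
  by rewrite absv0 mul0r.
move=> x y hx hy; apply: le_lt_trans (ler_wpM2r c0 (absvD_le v x y)) _.
by rewrite maxr_pMl // gt_max hx.
Qed.

(** With [u] the weights of a power series below, [i] is the right end of the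
    slope of its Newton polygon determined by the radius; on polynomials it
    counts the roots in the closed disc ([dominant_roots]). *)
Definition dominant (u : nat -> R) (i : nat) : Prop :=
  (forall k, u k <= u i) /\ (forall k, (i < k)%N -> u k < u i).

Lemma dominant_uniq u i j : dominant u i -> dominant u j -> i = j.
Proof.
move=> [mi li] [mj lj]; case: (ltngtP i j) => // h.
  by have := li _ h; rewrite ltNge mj.
by have := lj _ h; rewrite ltNge mi.
Qed.

Definition vanishing (u : nat -> R) : Prop :=
  forall e, 0 < e -> exists N, forall k, (N <= k)%N -> u k < e.

Lemma dominant_exists u k0 : vanishing u -> 0 < u k0 ->
  exists2 i, dominant u i & 0 < u i.
Proof.
move=> u0 uk0; have [N hN] := u0 _ uk0.
have [i hi] : exists i, forall k, u k <= u i.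
  pose i := [arg max_(i > (ord0 : 'I_(N + k0).+1)) u i]%O.
  exists i; rewrite /i; case: arg_maxP => // i0 _ hi0 k.
  have hk (j : nat) : (j <= N + k0)%N -> u j <= u i0.
    by rewrite -ltnS => lt_j; apply: (hi0 (Ordinal lt_j)).
  case: (leqP k (N + k0)) => [/hk//|lt_k].
  apply: le_trans (hk k0 (leq_addl _ _)); apply/ltW/hN.
  exact: leq_trans (leq_addr _ _) (ltnW lt_k).
have ui : 0 < u i by exact: lt_le_trans (hi k0).
pose Q i := `[< forall k, u k <= u i >].
have exQ : exists i, Q i by exists i; apply/asboolP.
have leQ j : Q j -> (j <= N)%N.
  move=> /asboolP hj; rewrite leqNgt; apply/negP => /ltnW /hN.
  by rewrite ltNge hj.
case: (ex_maxnP exQ leQ) => m /asboolP hm mmax.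
exists m; last by exact: lt_le_trans (hm i).
split=> // k lt_mk; rewrite lt_neqAle hm andbT; apply/negP => /eqP E.
have Qk : Q k by apply/asboolP => l; rewrite E.
by have := mmax k Qk; rewrite leqNgt lt_mk.
Qed.

Lemma vanishing_bounded u : (forall k, 0 <= u k) -> vanishing u ->
  exists2 B, 0 < B & forall k, u k <= B.
Proof.
move=> u0 uv; case: (pselect (exists k, 0 < u k)) => [[k uk]|h].
  by have [i [hi _] ui] := dominant_exists uv uk; exists (u i).
exists 1 => // k; apply: le_trans ler01; rewrite leNgt; apply/negP => uk.
by apply: h; exists k.
Qed.

Definition weight (r : R) (a : nat -> K) (k : nat) : R := v (a k) * r ^+ k.

Lemma weight_ge0 r a k : 0 <= r -> 0 <= weight r a k.
Proof. by move=> r0; rewrite mulr_ge0 ?absv_ge0 ?exprn_ge0. Qed.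

Lemma weight_gt0 r a k : 0 < r -> (0 < weight r a k) = (a k != 0).
Proof. by move=> r0; rewrite pmulr_lgt0 ?exprn_gt0 // absv_gt0. Qed.

Definition conv (a b : nat -> K) (n : nat) : K :=
  \sum_(i < n.+1) a i * b (n - i)%N.

Lemma weight_conv_term r (a b : nat -> K) n (i : 'I_n.+1) :
  v (a i * b (n - i)%N) * r ^+ n = weight r a i * weight r b (n - i).
Proof.
have le_in : (i <= n)%N by rewrite -ltnS.
by rewrite absvM /weight mulrACA -exprD subnKC.
Qed.

(** Gauss's lemma: among the products contributing to the coefficient of index
    [i + j], the one of the two dominant terms is strictly larger than the
    others, since any other pair of indices exceeds [i] or [j] on one side. *)
Lemma dominant_conv r a b i j : 0 < r ->
    dominant (weight r a) i -> dominant (weight r b) j ->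
    0 < weight r a i -> 0 < weight r b j ->
  dominant (weight r (conv a b)) (i + j) /\
  weight r (conv a b) (i + j) = weight r a i * weight r b j.
Proof.
move=> r0 [mi li] [mj lj] wi wj.
have rge0 := ltW r0.
have P0 : 0 < weight r a i * weight r b j by rewrite mulr_gt0.
have strict s t : (i < s)%N || (j < t)%N ->
    weight r a s * weight r b t < weight r a i * weight r b j.
  case/orP => [/li h|/lj h].
    apply: le_lt_trans (_ : weight r a s * weight r b j < _).
      by apply: ler_wpM2l => //; exact: weight_ge0.
    by rewrite ltr_pM2r.
  apply: le_lt_trans (_ : weight r a i * weight r b t < _).
    by apply: ler_wpM2r => //; exact: weight_ge0.
  by rewrite ltr_pM2l.
have E : weight r (conv a b) (i + j) = weight r a i * weight r b j.
  have lt_i : (i < (i + j).+1)%N by rewrite ltnS leq_addr.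
  have main := weight_conv_term r a b (Ordinal lt_i).
  rewrite /= addKn in main.
  rewrite /weight /conv (bigD1 (Ordinal lt_i)) //= addKn absvD_eq //.
  rewrite -(@ltr_pM2r _ (r ^+ (i + j))) ?exprn_gt0 // main.
  apply: absv_sum_lt => // [|s ne_s]; first exact: exprn_ge0.
  rewrite weight_conv_term; apply: strict.
  have : (s : nat) != i by apply: contraNneq ne_s => e; apply/eqP/val_inj.
  have := ltn_ord s; lia.
split=> //; split=> n; rewrite E.
  rewrite /weight /conv; apply: absv_sum_le => [||s _].
  - exact: exprn_ge0.
  - exact: ltW.
  - by rewrite weight_conv_term; apply: ler_pM => //; exact: weight_ge0.
move=> lt_n; rewrite /weight /conv; apply: absv_sum_lt => // [|s _].
  exact: exprn_ge0.
by rewrite weight_conv_term; apply: strict; lia.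
Qed.

Lemma absv_cvgP (u : nat -> K) l : absv_cvg v u l <->
  forall e : R, 0 < e -> exists N, forall k, (N <= k)%N -> v (u k - l) < e.
Proof.
rewrite /absv_cvg; split=> [/cvgrPdist_lt h e e0|h].
  have [N _ hN] := h _ e0; exists N => k /hN /=.
  by rewrite sub0r normrN ger0_norm ?absv_ge0.
apply/cvgrPdist_lt => e /h [N hN]; exists N => // k /hN /=.
by rewrite sub0r normrN ger0_norm ?absv_ge0.
Qed.

Lemma absv_cvg_uniq u l l' : absv_cvg v u l -> absv_cvg v u l' -> l = l'.
Proof.
move=> /absv_cvgP h /absv_cvgP h'; apply/eqP; rewrite -subr_eq0 -absv_neq0.
rewrite eq_le absv_ge0 andbT leNgt; apply/negP => e0.
have [N hN] := h _ e0; have [N' hN'] := h' _ e0.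
have h1 := hN _ (leq_maxl N N'); have h2 := hN' _ (leq_maxr N N').
set n := maxn N N' in h1 h2.
have := absvB_le (u n - l') (u n - l).
have -> : u n - l' - (u n - l) = l - l' by ring.
by rewrite le_max !leNgt h1 h2.
Qed.

End AbsoluteValue.

(** * Zeros of entire functions *)

Section PowerSeries.
Variables (K : fieldType) (R : realType) (v : nonarch_absval K R).
Implicit Types (a : nat -> K).

(** The radius [r] ranges over all positive reals rather than over the values
    of [v], so that the condition stays meaningful, and means polynomial, when
    [v] is trivial. *)
Definition entire_coefs a : Prop :=
  forall r, 0 < r -> vanishing (weight v r a).

Definition evalto a (z l : K) : Prop :=
  absv_cvg v (fun m => \sum_(k < m) a k * z ^+ k) l.

Definition trunc m a : {poly K} := \poly_(k < m) a k.

Lemma horner_trunc m a z : (trunc m a).[z] = \sum_(k < m) a k * z ^+ k.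
Proof. exact: horner_poly. Qed.

End PowerSeries.

Section Zeros.
Variables (K : closedFieldType) (R : realType) (v : nonarch_absval K R).
Hypothesis complete_v : absv_complete v.
Implicit Types (a : nat -> K) (r : R) (rs : seq K).

(** By Gauss's lemma it suffices to look at one factor ['X - z], where the
    dominant index is 1 if [v z <= r] and 0 otherwise. *)
Lemma dominant_roots r c rs : 0 < r -> c != 0 ->
  let a k := (c *: \prod_(z <- rs) ('X - z%:P))`_k in
  let i := count (fun z => v z <= r) rs in
  dominant (weight v r a) i /\ 0 < weight v r a i.
Proof.
move=> r0 c0; elim: rs => [|z rs [IHd IHw]] /=.
  have E k : (c *: \prod_(z <- [::]) ('X - z%:P))`_k = c *+ (k == 0%N).
    by rewrite big_nil coefZ coef1 mulr_natr.
  rewrite weight_gt0 // E /=; split=> //.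
  split=> [k|[//|k] _]; rewrite /weight !E /= expr0 mulr1.
    case: k => [|k] /=; first by rewrite expr0 mulr1.
    by rewrite mulr0n absv0 mul0r absv_ge0.
  by rewrite mulr0n absv0 mul0r absv_gt0.
pose b k := (('X - z%:P) : {poly K})`_k.
have wb0 : weight v r b 0 = v z.
  by rewrite /weight /b coefB coefX coefC /= sub0r absvN expr0 mulr1.
have wb1 : weight v r b 1 = r.
  by rewrite /weight /b coefB coefX coefC /= subr0 absv1 mul1r expr1.
have wb2 k : weight v r b k.+2 = 0.
  by rewrite /weight /b coefB coefX coefC /= subr0 absv0 mul0r.
have [bd bw] : dominant (weight v r b) (v z <= r)%R /\
               0 < weight v r b (v z <= r)%R.
  case: (lerP (v z) r) => h /=; rewrite /dominant ?wb0 ?wb1.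
    by split=> //; split=> [[|[|k]]|[|[|k]]]; rewrite ?wb0 ?wb1 ?wb2 // ltW.
  have vz : 0 < v z by exact: lt_trans h.
  by split=> //; split=> [[|[|k]]|[|[|k]]]; rewrite ?wb0 ?wb1 ?wb2 // ltW.
have [] := dominant_conv r0 bd IHd bw IHw.
set a' := conv _ _ => d E.
have -> : (fun k => (c *: \prod_(z <- z :: rs) ('X - z%:P))`_k) = a'.
  apply/funext => k; rewrite big_cons scalerAr coefM; apply: eq_bigr => i _.
  by [].
by split=> //; rewrite E mulr_gt0.
Qed.

(** Roots [y] outside the disc contribute equally to both sides, because
    [v (z - y) = v y] for them. *)
Lemma prod_root_distance r rs z d : 0 < r -> v z <= r -> 0 <= d ->
    (forall y, y \in rs -> v y <= r -> d <= v (z - y)) ->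
  v (\prod_(y <- rs) y) * d ^+ count (fun y => v y <= r) rs <=
  v (\prod_(y <- rs) (z - y)) * r ^+ count (fun y => v y <= r) rs.
Proof.
move=> r0 zr d0; elim: rs => [|y rs IH] h.
  by rewrite !big_nil /= !expr0.
have {}IH := IH (fun x xrs => h x (mem_behead (s := y :: rs) xrs)).
rewrite !big_cons !absvM /= !exprD.
case: (lerP (v y) r) => hy /=.
  rewrite !expr1 mulrACA [leRHS]mulrACA; apply: ler_pM => //.
  - by rewrite mulr_ge0 ?absv_ge0.
  - by rewrite mulr_ge0 ?exprn_ge0 ?absv_ge0.
  rewrite mulrC; apply: ler_pM; rewrite ?absv_ge0 //.
  by apply: h => //; rewrite mem_head.
have -> : v (z - y) = v y.
  by rewrite absvBC absvD_eq // absvN; exact: le_lt_trans hy.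
by rewrite !expr0 !mul1r -!mulrA ler_wpM2l ?absv_ge0.
Qed.

Lemma seq_minimizer (T : eqType) (f : T -> R) (s : seq T) : s != [::] ->
  exists2 x, x \in s & forall y, y \in s -> f x <= f y.
Proof.
elim: s => // x s IH _; case: (eqVneq s [::]) => [->|/IH [y ys hy]].
  by exists x; rewrite ?mem_head // => y; rewrite inE => /eqP ->.
case: (lerP (f x) (f y)) => h.
  exists x; first exact: mem_head.
  move=> t; rewrite inE => /predU1P [->//|/hy]; exact: le_trans.
exists y; first by rewrite inE ys orbT.
by move=> t; rewrite inE => /predU1P [->|/hy //]; exact: ltW.
Qed.

(** A small value at [z] forces a root close to [z].  The estimate involves
    [p] only through [p.[z]], the constant coefficient and the dominant index,
    hence is uniform over the truncations of a power series. *)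
Lemma near_root (p : {poly K}) r N z : 0 < r -> p != 0 ->
    dominant (weight v r (fun k => p`_k)) N -> (0 < N)%N -> v z <= r ->
  exists y, [/\ root p y, v y <= r &
    v p`_0 * v (z - y) ^+ N <= v p.[z] * r ^+ N].
Proof.
move=> r0 p0 pN N0 zr.
have [rs prs] := closed_field_poly_normal p.
have c0 : lead_coef p != 0 by rewrite lead_coef_eq0.
have [] := dominant_roots rs r0 c0; rewrite -prs => d _.
have {d} EN := dominant_uniq pN d.
pose s := [seq y <- rs | v y <= r].
have s0 : s != [::] by rewrite -size_eq0 size_filter -EN -lt0n.
have [y] := seq_minimizer (fun y => v (z - y)) s0.
rewrite mem_filter => /andP [yr yrs] ymin.
exists y; split=> //.
  by rewrite prs rootZ // root_prod_XsubC.
have := @prod_root_distance r rs z (v (z - y)) r0 zr (absv_ge0 v _).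
rewrite -EN => /(_ _)/(ler_wpM2l (absv_ge0 v (lead_coef p))).
rewrite !mulrA -!absvM.
have -> : lead_coef p * \prod_(y0 <- rs) (z - y0) = p.[z].
  rewrite {2}prs hornerZ horner_prod; congr (_ * _); apply: eq_bigr => x _.
  by rewrite hornerXsubC.
have -> : v (lead_coef p * \prod_(y0 <- rs) y0) = v p`_0.
  rewrite -horner_coef0 {2}prs hornerZ horner_prod !absvM; congr (_ * _).
  elim: (rs) => [|x t IH]; first by rewrite !big_nil.
  by rewrite !big_cons !absvM hornerXsubC sub0r absvN IH.
apply=> x xrs xr; apply: ymin; by rewrite mem_filter xr.
Qed.

Lemma trunc_lipschitz r a B m x y : 0 < r -> 0 < B ->
    (forall k, weight v r a k <= B) -> v x <= r -> v y <= r ->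
  v ((trunc m a).[x] - (trunc m a).[y]) * r <= v (x - y) * B.
Proof.
move=> r0 B0 hB xr yr; rewrite !horner_trunc -sumrB.
have rge0 := ltW r0.
apply: absv_sum_le => // [|k _]; first by rewrite mulr_ge0 ?absv_ge0 ?ltW.
rewrite -mulrBr absvM.
have pow n : v (x ^+ n - y ^+ n) * r <= v (x - y) * r ^+ n.
  elim: n => [|n IH]; first by rewrite !expr0 subrr absv0 mul0r mulr1 absv_ge0.
  have -> : x ^+ n.+1 - y ^+ n.+1 = x * (x ^+ n - y ^+ n) + (x - y) * y ^+ n.
    by rewrite !exprS; ring.
  apply: le_trans (ler_wpM2r rge0 (absvD_le v _ _)) _.
  rewrite maxr_pMl // ge_max !absvM exprS; apply/andP; split.
    rewrite -mulrA [leRHS]mulrCA; apply: ler_pM; rewrite ?absv_ge0 //.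
    by rewrite mulr_ge0 ?absv_ge0.
  rewrite -mulrA; apply: ler_wpM2l; first exact: absv_ge0.
  rewrite mulrC; apply: ler_wpM2l => //.
  by rewrite absvX lerXn2r ?nnegrE ?absv_ge0.
rewrite -mulrA; apply: le_trans (ler_wpM2l (absv_ge0 v _) (pow k)) _.
by rewrite mulrCA; apply: ler_wpM2l; rewrite ?absv_ge0 //; exact: hB.
Qed.

Lemma vanishing_steps_cauchy (s : nat -> K) :
  vanishing (fun k => v (s k.+1 - s k)) -> absv_cauchy v s.
Proof.
move=> h e e0; have [N hN] := h e e0; exists N.
have H d p : (N <= p)%N -> v (s (p + d)%N - s p) < e.
  move=> Np; elim: d => [|d IH]; first by rewrite addn0 subrr absv0.
  have -> : s (p + d.+1)%N - s p =
      (s (p + d).+1 - s (p + d)%N) + (s (p + d)%N - s p).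
    by rewrite addnS; ring.
  apply: le_lt_trans (absvD_le v _ _) _; rewrite gt_max IH hN //.
  exact: leq_trans (leq_addr _ _).
move=> p q Np Nq; case: (leqP p q) => [h'|/ltnW h'].
  by rewrite absvBC -(subnKC h') H.
by rewrite -(subnKC h') H.
Qed.

(** If [a 0 != 0], choose a radius whose dominant index [i] is positive.  All
    long truncations then have dominant index [i], hence roots in the closed
    disc.  A root of one truncation almost annihilates the next, so [near_root]
    yields a root of the next one nearby; the Cauchy sequence of roots built
    this way converges to a zero of the series. *)
Lemma entire_zero a k0 : entire_coefs v a -> (0 < k0)%N -> a k0 != 0 ->
  exists z, evalto v a z 0.
Proof.
move=> ea k00 ak0; case: (eqVneq (a 0%N) 0) => [a0|a0].
  exists 0; apply/absv_cvgP => e e0; exists 0%N => m _.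
  rewrite big1 ?subr0 ?absv0 // => -[[|k] lt_k] _ /=; rewrite ?a0 ?mul0r //.
  by rewrite exprS mul0r mulr0.
have vk0 : 0 < v (a k0) by rewrite absv_gt0.
(* This makes the weight of index [k0] larger than the one of index 0. *)
pose r := 1 + v (a 0%N) / v (a k0).
have r1 : 1 <= r by rewrite lerDl divr_ge0 ?absv_ge0.
have r0 : 0 < r by exact: lt_le_trans r1.
have rge0 := ltW r0.
have [i di wi] : exists2 i, dominant (weight v r a) i & 0 < weight v r a i.
  by apply: (dominant_exists (k0 := k0)); [exact: ea|rewrite weight_gt0].
have i0 : (0 < i)%N.
  rewrite lt0n; apply/eqP => i0; have := di.1 k0.
  rewrite i0 /weight expr0 mulr1.
  apply/negP; rewrite -ltNge; apply: lt_le_trans (_ : v (a k0) * r <= _).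
    rewrite mulrDr mulr1 mulrCA divff ?gt_eqF // mulr1; lra.
  by rewrite ler_wpM2l ?absv_ge0 // ler_eXnr.
have [B B0 hB] := vanishing_bounded (fun k => weight_ge0 v a k rge0) (ea r r0).
have tcoef m k : (trunc m a)`_k = if (k < m)%N then a k else 0.
  by rewrite coef_poly.
have dtrunc m : (i < m)%N -> dominant (weight v r (fun k => (trunc m a)`_k)) i.
  move=> lt_im; have E k : weight v r (fun k => (trunc m a)`_k) k =
      if (k < m)%N then weight v r a k else 0.
    by rewrite /weight tcoef; case: ifP => // _; rewrite absv0 mul0r.
  split=> k; rewrite !E lt_im; case: ifP => _; rewrite ?weight_ge0 //.
    exact: di.1.
  exact: di.2.
have t0 m : (i < m)%N -> trunc m a != 0.
  move=> lt_im; apply/eqP => /(congr1 (fun p : {poly K} => p`_0)).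
  by rewrite tcoef coef0 (leq_ltn_trans _ lt_im) // => /eqP; rewrite (negPf a0).
(* [next (k, z) y]: [y] is a root close to [z] of the truncation of length
   [(i + k).+1], which is long enough to contain the dominant term. *)
pose next (u : nat * K) y := v u.2 <= r ->
  [/\ root (trunc (i + u.1).+1 a) y, v y <= r &
    v (a 0%N) * v (u.2 - y) ^+ i <= v (trunc (i + u.1).+1 a).[u.2] * r ^+ i].
have [nxt hnxt] : {nxt & forall u, next u (nxt u)}.
  apply: choice => -[m z]; rewrite /next /=.
  case: (lerP (v z) r) => zr; last by exists 0.
  have lt_i : (i < (i + m).+1)%N by rewrite ltnS leq_addr.
  have [y [h1 h2 h3]] := near_root r0 (t0 _ lt_i) (dtrunc _ lt_i) i0 zr.
  by exists y => _; split => //; move: h3; rewrite tcoef.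
pose s := fix s k := if k is k'.+1 then nxt (k, s k') else nxt (0%N, 0).
have sr k : v (s k) <= r.
  elim: k => [|k IH] /=; first by have [] := hnxt (0%N, 0); rewrite /= ?absv0.
  by have [] := hnxt (k.+1, s k) IH.
have sroot k : (trunc (i + k).+1 a).[s k] = 0.
  apply/eqP; rewrite -rootE; case: k => [|k] /=.
    by have [] := hnxt (0%N, 0); rewrite /= ?absv0.
  by have [] := hnxt (k.+1, s k) (sr k).
have sstep k : v (a 0%N) * v (s k.+1 - s k) ^+ i <=
    weight v r a (i + k).+1 * r ^+ i.
  have [_ _] := hnxt (k.+1, s k) (sr k); rewrite /= absvBC => h.
  apply: le_trans h _; rewrite addnS ler_wpM2r ?exprn_ge0 //.
  have -> : (trunc (i + k).+2 a).[s k] = a (i + k).+1 * s k ^+ (i + k).+1.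
    by rewrite horner_trunc big_ord_recr /= -horner_trunc sroot add0r.
  rewrite absvM absvX ler_wpM2l ?absv_ge0 // lerXn2r ?nnegrE ?absv_ge0 //.
have va0 : 0 < v (a 0%N) by rewrite absv_gt0.
have [z sz] : exists z, absv_cvg v s z.
  apply: complete_v; apply: vanishing_steps_cauchy => e e0.
  have [N hN] : exists N, forall k, (N <= k)%N ->
      weight v r a k < v (a 0%N) * e ^+ i / r ^+ i.
    by apply: ea => //; rewrite divr_gt0 ?mulr_gt0 ?exprn_gt0.
  exists N => k Nk; rewrite -(ltr_pXn2r i0) ?nnegrE ?absv_ge0 ?ltW //.
  rewrite -(ltr_pM2l va0); apply: le_lt_trans (sstep k) _.
  rewrite -ltr_pdivlMr ?exprn_gt0 // hN // ltnW // ltnS.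
  by rewrite (leq_trans Nk) // leq_addl.
exists z.
have zr : v z <= r.
  move/absv_cvgP: sz => /(_ r r0) [N hN].
  have -> : z = s N - (s N - z) by ring.
  by apply: le_trans (absvB_le v _ _) _; rewrite ge_max sr ltW // hN.
apply/absv_cvgP => e e0; move/absv_cvgP: sz => /(_ (e * r / B)).
rewrite divr_gt0 ?mulr_gt0 // => /(_ isT) [N hN].
exists (i + N).+1 => m; rewrite subr0 -horner_trunc => le_m.
have [k -> Nk] : exists2 k, m = (i + k).+1 & (N <= k)%N.
  have lt_im : (i < m)%N by apply: leq_trans le_m; rewrite ltnS leq_addr.
  exists (m - i.+1)%N; first by rewrite -addSn subnKC.
  by rewrite leq_subRL // addSn.
have := trunc_lipschitz (i + k).+1 r0 B0 hB zr (sr k); rewrite sroot subr0.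
rewrite absvBC => h; rewrite -(ltr_pM2r r0); apply: le_lt_trans h _.
by rewrite -ltr_pdivlMr ?hN.
Qed.

End Zeros.

(** * The ring of entire functions *)

Lemma unbounded_powers (R : realType) (x r : R) :
  1 < x -> exists n, r <= x ^+ n.
Proof.
move=> x1; pose d := x - 1; have d0 : 0 < d by rewrite subr_gt0.
have bern n : 1 + d *+ n <= x ^+ n.
  elim: n => [|n IH]; first by rewrite mulr0n addr0 expr0.
  have -> : x ^+ n.+1 = x ^+ n + x ^+ n * d by rewrite exprSr /d; ring.
  by rewrite mulrSr addrA lerD // ler_peMl ?(ltW d0) // exprn_ege1 // ltW.
exists (Num.bound `|r / d|); apply: le_trans (bern _).
have : r / d < (Num.bound `|r / d|)%:R.
  by apply: le_lt_trans (ler_norm _) _; exact: archi_boundP.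
by rewrite ltr_pdivrMr // mulr_natl; lra.
Qed.

Section EntireCoefs.
Variables (K : fieldType) (R : realType) (v : nonarch_absval K R).
Implicit Types (a b : nat -> K).

(** If [v] takes a value larger than 1, its values are unbounded and the claim
    follows from the convergence at points of large absolute value.  Otherwise
    every nonzero element has absolute value 1, and convergence at 1 makes the
    series a polynomial. *)
Lemma analytic_entire a :
  (forall z, exists l, evalto v a z l) -> entire_coefs v a.
Proof.
move=> ha.
have tv z : vanishing (fun k => v (a k * z ^+ k)).
  move=> e e0; have [l /absv_cvgP hl] := ha z; have [N hN] := hl e e0.
  exists N => k Nk; have h1 := hN _ Nk.
  have h2 := hN _ (leq_trans Nk (leqnSn k)).
  move: h2; rewrite big_ord_recr /=; set S := \sum_(i < k) _ in h1 * => h2.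
  have -> : a k * z ^+ k = (S + a k * z ^+ k - l) - (S - l) by ring.
  by apply: le_lt_trans (absvB_le v _ _) _; rewrite gt_max h1 h2.
move=> r r0 e e0; case: (pselect (exists z, 1 < v z)) => [[z vz]|h].
  have [n rn] := unbounded_powers r vz.
  have [N hN] := tv (z ^+ n) _ e0; exists N => k /hN; apply: le_lt_trans.
  rewrite absvM !absvX /weight ler_wpM2l ?absv_ge0 //.
  by rewrite lerXn2r ?nnegrE ?(ltW r0) ?exprn_ge0 ?absv_ge0.
have [N hN] := tv 1 _ ltr01; exists N => k /hN; rewrite expr1n mulr1 => ak.
suff a0 : a k = 0 by rewrite /weight a0 absv0 mul0r.
apply/eqP/negPn/negP => ak0; apply: h; exists (a k)^-1.
have : v (a k) * v (a k)^-1 = 1 by rewrite -absvM divff // absv1.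
have : 0 < v (a k) by rewrite absv_gt0.
nra.
Qed.

Lemma entire_coefsB a b : entire_coefs v a -> entire_coefs v b ->
  entire_coefs v (fun k => a k - b k).
Proof.
move=> ha hb r r0 e e0.
have [N hN] := ha r r0 e e0; have [N' hN'] := hb r r0 e e0.
exists (maxn N N') => k; rewrite geq_max => /andP [/hN h /hN' h'].
have rk : 0 <= r ^+ k by rewrite exprn_ge0 ?ltW.
apply: le_lt_trans (ler_wpM2r rk (absvB_le v _ _)) _.
by rewrite maxr_pMl // gt_max h h'.
Qed.

Lemma entire_coefs_const c : entire_coefs v (fun k => c *+ (k == 0%N)).
Proof.
move=> r r0 e e0; exists 1%N => -[|k] // _.
by rewrite /weight mulr0n absv0 mul0r.
Qed.

Lemma conv_terms_vanishing a b r e : entire_coefs v a -> entire_coefs v b ->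
  0 < r -> 0 < e ->
  exists N, forall s t, (N <= s + t)%N -> weight v r a s * weight v r b t < e.
Proof.
move=> ha hb r0 e0; have rge0 := ltW r0.
have [A A0 hA] := vanishing_bounded (fun k => weight_ge0 v a k rge0) (ha r r0).
have [B B0 hB] := vanishing_bounded (fun k => weight_ge0 v b k rge0) (hb r r0).
have [N hN] := ha r r0 _ (divr_gt0 e0 B0).
have [N' hN'] := hb r r0 _ (divr_gt0 e0 A0).
exists (N + N')%N => s t st.
have [|] : (N <= s)%N \/ (N' <= t)%N by lia.
  move=> /hN h; rewrite ltr_pdivlMr // in h; apply: le_lt_trans h.
  by rewrite ler_wpM2l ?weight_ge0.
move=> /hN' h; rewrite ltr_pdivlMr // mulrC in h; apply: le_lt_trans h.
by rewrite ler_wpM2r ?weight_ge0.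
Qed.

Lemma entire_coefs_conv a b : entire_coefs v a -> entire_coefs v b ->
  entire_coefs v (conv a b).
Proof.
move=> ha hb r r0 e e0; have [N hN] := conv_terms_vanishing ha hb r0 e0.
exists N => n Nn; apply: absv_sum_lt => // [|s _].
  by rewrite exprn_ge0 ?ltW.
by rewrite weight_conv_term hN // subnKC // -ltnS.
Qed.

(** Reduces the ring laws of power series to those of polynomials: every
    coefficient of a product depends on finitely many coefficients only. *)
Lemma coef_conv (p q : {poly K}) a b n :
  (forall k, (k <= n)%N -> p`_k = a k) ->
  (forall k, (k <= n)%N -> q`_k = b k) ->
  (p * q)`_n = conv a b n.
Proof.
move=> hp hq; rewrite coefM; apply: eq_bigr => i _.
by rewrite hp ?hq ?leq_subr // -ltnS.
Qed.

Lemma coef_trunc m a k : (k < m)%N -> (trunc m a)`_k = a k.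
Proof. by rewrite coef_poly => ->. Qed.

Lemma convC a b : conv a b = conv b a.
Proof.
apply/funext => n.
have ha := @coef_trunc n.+1 a; have hb := @coef_trunc n.+1 b.
by rewrite -(coef_conv ha hb) mulrC (coef_conv hb ha).
Qed.

Lemma convA a b c : conv a (conv b c) = conv (conv a b) c.
Proof.
apply/funext => n.
have ha := @coef_trunc n.+1 a; have hb := @coef_trunc n.+1 b.
have hc := @coef_trunc n.+1 c.
have hbc k : (k <= n)%N -> (trunc n.+1 b * trunc n.+1 c)`_k = conv b c k.
  by move=> kn; apply: coef_conv => i ik; apply: coef_trunc; lia.
have hab k : (k <= n)%N -> (trunc n.+1 a * trunc n.+1 b)`_k = conv a b k.
  by move=> kn; apply: coef_conv => i ik; apply: coef_trunc; lia.
by rewrite -(coef_conv ha hbc) mulrA (coef_conv hab hc).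
Qed.

Lemma conv_const c a : conv (fun k => c *+ (k == 0%N)) a = fun k => c * a k.
Proof.
apply/funext => n; rewrite /conv big_ord_recl /= mulr1n subn0 big1 ?addr0 //.
by move=> i _; rewrite mulr0n mul0r.
Qed.

Lemma convDl a b c :
  conv (fun k => a k + b k) c = fun k => conv a c k + conv b c k.
Proof.
apply/funext => n; rewrite /conv -big_split; apply: eq_bigr => i _.
exact: mulrDl.
Qed.

Lemma evalto_const c z : evalto v (fun k => c *+ (k == 0%N)) z c.
Proof.
apply/absv_cvgP => e e0; exists 1%N => -[//|m] _.
rewrite big_ord_recl /= mulr1n expr0 mulr1 big1 ?addr0 ?subrr ?absv0 //.
by move=> i _; rewrite mulr0n mul0r.
Qed.

Lemma evaltoD a b z l l' : evalto v a z l -> evalto v b z l' ->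
  evalto v (fun k => a k + b k) z (l + l').
Proof.
move=> /absv_cvgP ha /absv_cvgP hb; apply/absv_cvgP => e e0.
have [N hN] := ha e e0; have [N' hN'] := hb e e0.
exists (maxn N N') => k; rewrite geq_max => /andP [/hN h /hN' h'].
under eq_bigr do rewrite mulrDl.
rewrite big_split /= opprD addrACA; apply: le_lt_trans (absvD_le v _ _) _.
by rewrite gt_max h h'.
Qed.

(** The product of two truncations and the truncation of the product have the
    same coefficients below [m]; the remaining coefficients of the former are
    sums of products in which at least one factor has a large index, and these
    are small. *)
Lemma evaltoM a b z l l' : entire_coefs v a -> entire_coefs v b ->
  evalto v a z l -> evalto v b z l' -> evalto v (conv a b) z (l * l').
Proof.
move=> ea eb /absv_cvgP ha /absv_cvgP hb; apply/absv_cvgP => e e0.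
pose M := 1 + v l + v l'.
have vl := absv_ge0 v l; have vl' := absv_ge0 v l'.
have M0 : 0 < M by rewrite /M; lra.
pose d := Num.min 1 (e / M).
have d0 : 0 < d by rewrite lt_min ltr01 divr_gt0.
have dM : d * M <= e by rewrite -ler_pdivlMr // /d ge_min lexx orbT.
have d1 : d <= 1 by rewrite /d ge_min lexx.
have [N1 h1] := ha d d0; have [N2 h2] := hb d d0.
pose r := Num.max 1 (v z).
have r0 : 0 < r by rewrite lt_max ltr01.
have zr : v z <= r by rewrite le_max lexx orbT.
have [N3 h3] := conv_terms_vanishing ea eb r0 e0.
exists (maxn N1 (maxn N2 N3)) => m; rewrite !geq_max => /and3P [m1 m2 m3].
rewrite -horner_trunc.
have {}h1 := h1 _ m1; have {}h2 := h2 _ m2; rewrite -horner_trunc in h1.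
rewrite -horner_trunc in h2.
set x := (trunc m a).[z] in h1; set y := (trunc m b).[z] in h2.
have hxy : v (x * y - l * l') < e.
  have -> : x * y - l * l' =
      (x - l) * (y - l') + ((x - l) * l' + l * (y - l')) by ring.
  have x0 := absv_ge0 v (x - l); have y0 := absv_ge0 v (y - l').
  apply: le_lt_trans (absvD_le v _ _) _; rewrite gt_max absvM.
  apply/andP; split; first by rewrite /M in dM; nra.
  apply: le_lt_trans (absvD_le v _ _) _; rewrite gt_max !absvM.
  by apply/andP; split; rewrite /M in dM; nra.
have hq : v (x * y - (trunc m (conv a b)).[z]) < e.
  rewrite -hornerM -hornerN -hornerD horner_coef -[v _]mulr1.
  apply: absv_sum_lt => // i _; rewrite mulr1 coefB.
  case: (ltnP i m) => im.
    rewrite coef_trunc // (@coef_conv _ _ a b) ?subrr ?mul0r ?absv0 //.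
      by move=> k ki; apply: coef_trunc; exact: leq_ltn_trans im.
    by move=> k ki; apply: coef_trunc; exact: leq_ltn_trans im.
  rewrite [X in _ - X]coef_poly ltnNge im /= subr0 absvM absvX.
  apply: le_lt_trans (_ : v (trunc m a * trunc m b)`_i * r ^+ i < _).
    by rewrite ler_wpM2l ?absv_ge0 // lerXn2r ?nnegrE ?absv_ge0 ?(ltW r0).
  rewrite coefM; apply: absv_sum_lt => // [|j _].
    by rewrite exprn_ge0 ?ltW.
  rewrite !coef_poly; case: ifP; last by rewrite mul0r absv0 mul0r.
  case: ifP; last by rewrite mulr0 absv0 mul0r.
  by move=> _ _; rewrite weight_conv_term h3 // subnKC ?(leq_trans m3) // -ltnS.
have -> : (trunc m (conv a b)).[z] - l * l' =
  (x * y - l * l') - (x * y - (trunc m (conv a b)).[z]) by ring.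
by apply: le_lt_trans (absvB_le v _ _) _; rewrite gt_max hxy hq.
Qed.

End EntireCoefs.

Section EntireRing.
Variables (K : fieldType) (R : realType) (v : nonarch_absval K R).

Record entire := Entire {
  coefs :> nat -> K;
  coefsP : `[< entire_coefs v coefs >]
}.

HB.instance Definition _ := [isSub for coefs].
HB.instance Definition _ := [Choice of entire by <:].

Implicit Types f g h : entire.

Lemma entireE f : entire_coefs v f.
Proof. exact/asboolP/coefsP. Qed.

Lemma entire_eq f g : coefs f = coefs g -> f = g.
Proof. exact: val_inj. Qed.

Definition entire_const c := Entire (asboolT (entire_coefs_const v c)).

Definition entire_sub f g :=
  Entire (asboolT (entire_coefsB (entireE f) (entireE g))).

Definition entire_opp f := entire_sub (entire_const 0) f.

Definition entire_add f g := entire_sub f (entire_opp g).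

Definition entire_mul f g :=
  Entire (asboolT (entire_coefs_conv (entireE f) (entireE g))).

Lemma entire_oppE f k : entire_opp f k = - f k.
Proof. by rewrite /= mul0rn sub0r. Qed.

Lemma entire_addE f g k : entire_add f g k = f k + g k.
Proof. by rewrite /= mul0rn sub0r opprK. Qed.

Fact entire_addA : associative entire_add.
Proof.
by move=> f g h; apply/entire_eq/funext => k; rewrite !entire_addE addrA.
Qed.

Fact entire_addC : commutative entire_add.
Proof.
by move=> f g; apply/entire_eq/funext => k; rewrite !entire_addE addrC.
Qed.

Fact entire_add0 : left_id (entire_const 0) entire_add.
Proof.
by move=> f; apply/entire_eq/funext => k; rewrite !entire_addE /= mul0rn add0r.
Qed.

Fact entire_addN : left_inverse (entire_const 0) entire_opp entire_add.
Proof.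
move=> f; apply/entire_eq/funext => k.
by rewrite !entire_addE entire_oppE addNr /= mul0rn.
Qed.

HB.instance Definition _ := GRing.isZmodule.Build entire
  entire_addA entire_addC entire_add0 entire_addN.

Fact entire_mulA : associative entire_mul.
Proof. by move=> f g h; apply: entire_eq; exact: convA. Qed.

Fact entire_mulC : commutative entire_mul.
Proof. by move=> f g; apply: entire_eq; exact: convC. Qed.

Fact entire_mul1 : left_id (entire_const 1) entire_mul.
Proof.
move=> f; apply/entire_eq; rewrite /= conv_const.
by apply/funext => k; rewrite mul1r.
Qed.

Fact entire_mulDl : left_distributive entire_mul entire_add.
Proof.
move=> f g h; apply/entire_eq/funext => k; rewrite entire_addE.
change (conv (entire_add f g) h k = conv f h k + conv g h k).
have -> : coefs (entire_add f g) = (fun k => f k + g k).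
  by apply/funext => i; rewrite entire_addE.
by rewrite convDl.
Qed.

Fact entire_one_neq0 : entire_const 1 != 0 :> entire.
Proof.
apply/eqP => /(congr1 (fun f : entire => f 0%N)) /=.
by rewrite mulr1n mul0rn => /eqP; rewrite oner_eq0.
Qed.

HB.instance Definition _ := GRing.Zmodule_isComNzRing.Build entire
  entire_mulA entire_mulC entire_mul1 entire_mulDl entire_one_neq0.

Lemma coefsD f g k : (f + g) k = f k + g k.
Proof. exact: entire_addE. Qed.

Lemma coefsN f k : (- f) k = - f k.
Proof. exact: entire_oppE. Qed.

Lemma coefsB f g k : (f - g) k = f k - g k.
Proof. by rewrite coefsD coefsN. Qed.

Lemma coefsM f g : coefs (f * g) = conv f g.
Proof. by []. Qed.

Lemma coefs0 k : (0 : entire) k = 0.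
Proof. exact: mul0rn. Qed.

Lemma entire_neq0P f : f != 0 -> exists k, f k != 0.
Proof.
move=> f0; apply: contrapT => h; move/eqP: f0; apply.
apply/entire_eq/funext => k.
by rewrite coefs0; apply/eqP/negPn/negP => fk; apply: h; exists k.
Qed.

Lemma dominant_entire r f : 0 < r -> f != 0 ->
  exists2 i, dominant (weight v r f) i & 0 < weight v r f i.
Proof.
move=> r0 /entire_neq0P [k fk].
by apply: (dominant_exists (k0 := k)); [exact: entireE|rewrite weight_gt0].
Qed.

Fact entire_const_zmod : zmod_morphism entire_const.
Proof.
by move=> c d; apply/entire_eq/funext => k; rewrite coefsB /= mulrnBl.
Qed.

Fact entire_const_monoid : monoid_morphism entire_const.
Proof.
split=> // c d; apply/entire_eq/funext => k.
by rewrite coefsM conv_const /= mulrnAr.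
Qed.

HB.instance Definition _ :=
  GRing.isZmodMorphism.Build K entire entire_const entire_const_zmod.
HB.instance Definition _ :=
  GRing.isMonoidMorphism.Build K entire entire_const entire_const_monoid.

Definition entire_unit : {pred entire} := fun f => `[< exists g, g * f = 1 >].

Definition entire_inv f : entire :=
  if pselect (exists g, g * f = 1) is left h then sval (cid h) else f.

Fact entire_mulVx : {in entire_unit, left_inverse 1 entire_inv *%R}.
Proof.
move=> f /asboolP h; rewrite /entire_inv; case: pselect => // h'.
by case: (cid h').
Qed.

Fact entire_unitPl f g : g * f = 1 -> entire_unit f.
Proof. by move=> h; apply/asboolP; exists g. Qed.

Fact entire_invr_out : {in [predC entire_unit], entire_inv =1 id}.
Proof.
move=> f /asboolP h; rewrite /entire_inv; case: pselect => //.
Qed.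

HB.instance Definition _ := GRing.ComNzRing_hasMulInverse.Build entire
  entire_mulVx entire_unitPl entire_invr_out.

(** A product of dominant terms is nonzero. *)
Fact entire_integral : GRing.integral_domain_axiom entire.
Proof.
move=> f g fg0; apply/norP => -[f0 g0].
have [i di wi] := dominant_entire ltr01 f0.
have [j dj wj] := dominant_entire ltr01 g0.
have [_] := dominant_conv ltr01 di dj wi wj.
rewrite -coefsM fg0 /weight coefs0 absv0 mul0r => /esym/eqP.
by rewrite gt_eqF // mulr_gt0.
Qed.

HB.instance Definition _ :=
  GRing.ComUnitRing_isIntegral.Build entire entire_integral.

End EntireRing.

(** * Evaluation of multivariate polynomials *)

Section MmapTheory.
Variables (n : nat) (K : fieldType).

Lemma mpoly_subalgebra_ind (P : mpoly n K -> Prop) :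
  (forall c, P (mpolyC n c)) -> (forall i, P (mpolyX K (mnm1 i))) ->
  (forall p q, P p -> P q -> P (p + q)) ->
  (forall p q, P p -> P q -> P (p * q)) ->
  forall p, P p.
Proof.
move=> hC hX hD hM; apply: mpolyind => [|c m p _ _ hp].
  by rewrite -(mpolyC0 n).
apply: (hD _ _) => //; rewrite -mul_mpolyC; apply: (hM _ _) => //.
rewrite mpolyXE_id; apply: (big_ind P); [by rewrite -mpolyC1|exact: hM|].
move=> i _; elim: (fun_of_multinom m i) => [|k IH].
  by rewrite expr0 -mpolyC1.
by rewrite exprS; apply: (hM _ _).
Qed.

Lemma mmapM (S : comNzRingType) (f : {rmorphism K -> S}) (x : 'I_n -> S)
    (p q : mpoly n K) :
  mmap f x (p * q) = mmap f x p * mmap f x q.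
Proof. exact: rmorphM. Qed.

Lemma mmap_homog (S : comNzRingType) (f : {rmorphism K -> S}) (P : mpoly n K) d
    (x : 'I_n -> S) l :
  P \is ishomog1 d mdeg -> mmap f (fun j => l * x j) P = l ^+ d * mmap f x P.
Proof.
move=> /dhomogP hP; rewrite /mmap mulr_sumr big_seq [RHS]big_seq.
apply: eq_bigr => m /hP dm; rewrite mulrCA; congr (_ * _).
have {dm} <- : mdeg m = d by exact: dm.
rewrite /mmap1 mdegE -prodrXr -big_split; apply: eq_bigr => i _.
by rewrite exprMn.
Qed.

Lemma rmorph_mmap (S T : comNzRingType) (f : {rmorphism K -> S})
    (g : {rmorphism S -> T}) (x : 'I_n -> S) (P : mpoly n K) :
  g (mmap f x P) = mmap (g \o f) (g \o x) P.
Proof.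
rewrite /mmap rmorph_sum; apply: eq_bigr => m _; rewrite rmorphM; congr (_ * _).
by rewrite /mmap1 rmorph_prod; apply: eq_bigr => i _; rewrite rmorphXn.
Qed.

End MmapTheory.

Lemma evalto_mmap (n : nat) (K : fieldType) (R : realType)
    (v : nonarch_absval K R) (F : 'I_n -> entire v) (x : 'I_n -> K) z
    (P : mpoly n K) :
  (forall j, evalto v (F j) z (x j)) ->
  evalto v (mmap (@entire_const K R v) F P) z (meval x P).
Proof.
move=> hF; move: P; apply: mpoly_subalgebra_ind => [c|j|p q hp hq|p q hp hq].
- by rewrite mmapC mevalC; exact: evalto_const.
- by rewrite mmapX mmap1U mevalXU.
- rewrite mmapD mevalD.
  set f := mmap _ F p; set g := mmap _ F q.
  have -> : coefs (f + g) = fun k => f k + g k.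
    by apply/funext => k; rewrite coefsD.
  exact: evaltoD.
- rewrite mmapM mevalM coefsM; apply: evaltoM => //; exact: entireE.
Qed.

(** * Places with values in an algebraically closed field *)

Section Places.
Variables (K : closedFieldType) (L : fieldType) (iota : {rmorphism K -> L}).

(** A ring homomorphism to [K] from a subring of [L] containing [K], identity
    on [K], given by its graph.  In this form domains need no subring type,
    and extension of homomorphisms is inclusion of sets, as Zorn's lemma
    wants it. *)
Record partial_hom (G : set (L * K)) : Prop := PartialHom {
  phom_const : forall c, G (iota c, c);
  phomB : forall x y a b, G (x, a) -> G (y, b) -> G (x - y, a - b);
  phomM : forall x y a b, G (x, a) -> G (y, b) -> G (x * y, a * b);
  phom_fun : forall a, G (0, a) -> a = 0
}.

(** With [partial_hom], this says that the domain is a valuation ring of [L],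
    so that [G] is a place with residue field [K]. *)
Definition total_phom (G : set (L * K)) : Prop :=
  forall x, x != 0 -> (exists a, G (x, a)) \/ (exists a, G (x^-1, a)).

Section PartialHomTheory.
Variables (G : set (L * K)) (hG : partial_hom G).

Lemma phom0 : G (0, 0).
Proof. by have := phom_const hG 0; rewrite rmorph0. Qed.

Lemma phom1 : G (1, 1).
Proof. by have := phom_const hG 1; rewrite rmorph1. Qed.

Lemma phomN x a : G (x, a) -> G (- x, - a).
Proof. by move=> h; have := phomB hG phom0 h; rewrite !sub0r. Qed.

Lemma phomD x y a b : G (x, a) -> G (y, b) -> G (x + y, a + b).
Proof. by move=> hx /phomN hy; have := phomB hG hx hy; rewrite !opprK. Qed.

Lemma phom_inj x a b : G (x, a) -> G (x, b) -> a = b.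
Proof.
move=> ha hb; have := phomB hG ha hb; rewrite subrr => /(phom_fun hG)/eqP.
by rewrite subr_eq0 => /eqP.
Qed.

Lemma phom_sum (I : Type) (r : seq I) (P : pred I) (F : I -> L) (f : I -> K) :
  (forall i, P i -> G (F i, f i)) ->
  G (\sum_(i <- r | P i) F i, \sum_(i <- r | P i) f i).
Proof.
move=> h; apply: (big_ind2 (fun x a => G (x, a))) => //; first exact: phom0.
by move=> *; apply: phomD.
Qed.

Definition lifts (q : {poly L}) (p : {poly K}) := forall i, G (q`_i, p`_i).

Lemma liftsB q q' p p' : lifts q p -> lifts q' p' -> lifts (q - q') (p - p').
Proof. by move=> h h' i; rewrite !coefB; apply: (phomB hG). Qed.

Lemma liftsM q q' p p' : lifts q p -> lifts q' p' -> lifts (q * q') (p * p').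
Proof.
move=> h h' i; rewrite !coefM; apply: phom_sum => j _; exact: (phomM hG).
Qed.

Lemma liftsC x a : G (x, a) -> lifts x%:P a%:P.
Proof. by move=> h i; rewrite !coefC; case: eqP => // _; exact: phom0. Qed.

Lemma lifts_map p : lifts (map_poly iota p) p.
Proof. by move=> i; rewrite coef_map; apply: (phom_const hG). Qed.

Lemma liftsXn n : lifts 'X^n 'X^n.
Proof. by have := lifts_map 'X^n; rewrite map_polyXn. Qed.

(** An ideal of [{poly K}]: [a] can be taken as a value at [x] exactly when it
    is a common root of this ideal. *)
Definition vanishing_reduction x : set {poly K} :=
  [set p | exists2 q, lifts q p & q.[x] = 0].

Lemma vanishing_reductionB x p p' :
  vanishing_reduction x p -> vanishing_reduction x p' ->
  vanishing_reduction x (p - p').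
Proof.
move=> [q hq q0] [q' hq' q0']; exists (q - q'); first exact: liftsB.
by rewrite hornerD hornerN q0 q0' subrr.
Qed.

Lemma vanishing_reductionM x p p' :
  vanishing_reduction x p -> vanishing_reduction x (p * p').
Proof.
move=> [q hq q0]; exists (q * map_poly iota p').
  by apply: liftsM => //; exact: lifts_map.
by rewrite hornerM q0 mul0r.
Qed.

(** A generator of this principal ideal is zero or nonconstant, hence has a
    root because [K] is algebraically closed. *)
Lemma vanishing_reduction_root x : ~ vanishing_reduction x 1 ->
  exists a, forall p, vanishing_reduction x p -> root p a.
Proof.
move=> J1; case: (pselect (exists2 p, vanishing_reduction x p & p != 0)).
  move=> [p1 Jp1 p10]; pose sizes m :=
    `[< exists p, [/\ vanishing_reduction x p, p != 0 & size p = m] >].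
  have /ex_minnP [m] : exists m, sizes m.
    by exists (size p1); apply/asboolP; exists p1.
  move=> /asboolP [g [Jg g0 sg]] gmin.
  have gdvd p : vanishing_reduction x p -> g %| p.
    move=> Jp; rewrite /dvdp; apply/negPn/negP => r0.
    have Jr : vanishing_reduction x (p %% g).
      have -> : p %% g = p - g * (p %/ g).
        by rewrite {2}(divp_eq p g) mulrC addrC addrA addNr add0r.
      by apply: vanishing_reductionB => //; apply: vanishing_reductionM.
    have : (size g <= size (p %% g)%R)%N.
      by rewrite sg; apply: gmin; apply/asboolP; exists (p %% g).
    by rewrite leqNgt ltn_modp g0.
  have : size g != 1%N.
    apply/negP => /size_poly1P [c c0 gc]; apply: J1.
    have -> : 1 = g * (c^-1)%:P by rewrite gc -polyCM divff.
    exact: vanishing_reductionM.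
  move/closed_rootP => [a ga]; exists a => p /gdvd /dvdpP [q ->].
  by rewrite rootM ga orbT.
move=> h; exists 0 => p Jp; case: (eqVneq p 0) => [->|p0]; first exact: root0.
by case: h; exists p.
Qed.

Definition adjoin x a : set (L * K) :=
  [set u | exists q p, [/\ lifts q p, u.1 = q.[x] & u.2 = p.[a]]].

Lemma adjoin_partial_hom x a :
  (forall p, vanishing_reduction x p -> root p a) -> partial_hom (adjoin x a).
Proof.
move=> hroot; split.
- move=> c; exists (iota c)%:P, c%:P; split; rewrite ?hornerC //.
  by apply: liftsC; apply: (phom_const hG).
- move=> _ _ _ _ [q [p [h /= -> ->]]] [q' [p' [h' /= -> ->]]].
  by exists (q - q'), (p - p'); rewrite !hornerE; split=> //; apply: liftsB.
- move=> _ _ _ _ [q [p [h /= -> ->]]] [q' [p' [h' /= -> ->]]].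
  by exists (q * q'), (p * p'); rewrite !hornerE; split=> //; apply: liftsM.
- move=> b [q [p [h /= q0 ->]]]; apply/eqP; rewrite -rootE; apply: hroot.
  by exists q.
Qed.

Lemma adjoin_sub x a : G `<=` adjoin x a.
Proof.
move=> [y b] h; exists y%:P, b%:P; rewrite !hornerC; split=> //.
exact: liftsC.
Qed.

Lemma adjoin_mem x a : adjoin x a (x, a).
Proof. by exists 'X, 'X; rewrite !hornerX; split=> //; exact: (liftsXn 1). Qed.

(** Relations 1 + u_0 + u_1 x + ... + u_n x^n = 0 and
    1 + v_0 + v_1 x^-1 + ... + v_m x^-m = 0, whose [u_i] and [v_j] have value
    0, cannot coexist: if m <= n, the second one eliminates x^n from the first
    one, and the degrees decrease until 1 + u_0 = 0. *)
Lemma no_inverse_pole x : x != 0 ->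
  vanishing_reduction x 1 -> vanishing_reduction x^-1 1 -> False.
Proof.
move=> x0 [q hq qx] [q' hq' qx'].
have [N le_N] := ubnP (size q + size q')%N.
elim: N => // N IH in x x0 q q' hq hq' qx qx' le_N *.
wlog le_qq' : x x0 q q' hq hq' qx qx' le_N / (size q' <= size q)%N.
  move=> wl; case: (leqP (size q') (size q)) => [h|/ltnW h].
    exact: (wl x x0 q q').
  by apply: (wl x^-1 _ q' q) => //; rewrite ?invr_eq0 ?invrK // addnC.
have n1 : (1 < size q)%N.
  rewrite ltnNge; apply/negP => /size1_polyC qc.
  move: qx (hq 0%N); rewrite qc hornerC coefC eqxx => ->.
  by move/(phom_fun hG); rewrite coef1 eqxx => /eqP; rewrite oner_eq0.
(* [rq'] is x^n q'(1/x), written as a polynomial in x. *)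
set n := (size q).-1; have nE : size q = n.+1 by rewrite /n prednK // ltnW.
pose rq' := \poly_(i < n.+1) q'`_(n - i).
pose rp' : {poly K} := \poly_(i < n.+1) (1 : {poly K})`_(n - i).
have hr : lifts rq' rp'.
  by move=> i; rewrite !coef_poly; case: ifP => // _; exact: phom0.
have rx : rq'.[x] = 0.
  rewrite horner_poly (reindex_inj rev_ord_inj) /=.
  have sq' : (size q' <= n.+1)%N by rewrite -nE.
  transitivity (x ^+ n * q'.[x^-1]); last by rewrite qx' mulr0.
  rewrite (horner_coef_wide _ sq') mulr_sumr; apply: eq_bigr => i _.
  have le_in : (i <= n)%N by rewrite -ltnS.
  rewrite /= subSS subKn // mulrCA; congr (_ * _).
  have -> : x ^+ n = x ^+ (n - i) * x ^+ i by rewrite -exprD subnK.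
  by rewrite -mulrA -exprMn divff // expr1n mulr1.
pose q1 := q'`_0 *: q - q`_n *: rq'.
apply: (IH x x0 q1 q') => //.
- have h0 : G (q'`_0, 1) by have := hq' 0%N; rewrite coef1.
  have hn : G (q`_n, 0).
    by have := hq n; rewrite coef1 -[n == _]negbK -lt0n -ltnS -nE n1.
  have := liftsB (liftsM (liftsC h0) hq) (liftsM (liftsC hn) hr).
  by rewrite !mul_polyC scale0r subr0 scale1r.
- by rewrite /q1 !hornerE qx rx !mulr0 subrr.
- move: le_N; rewrite ltnS; apply: leq_trans; rewrite ltn_add2r nE ltnS.
  apply/leq_sizeP => j; rewrite leq_eqVlt => /predU1P [<-|lt_nj].
    by rewrite coefB !coefZ coef_poly ltnSn subnn mulrC subrr.
  rewrite coefB !coefZ coef_poly ltnS leqNgt lt_nj mulr0 subr0.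
  by rewrite (@nth_default _ _ q) ?mulr0 // nE.
Qed.

End PartialHomTheory.

(** A maximal extension is a place: by [no_inverse_pole] one of x and 1/x can
    be given a value by [adjoin]. *)
Theorem place_extension G0 : partial_hom G0 ->
  exists G, [/\ partial_hom G, G0 `<=` G & total_phom G].
Proof.
move=> hG0.
(* The empty set is included because it is the union of the empty chain. *)
pose P (X : set (L * K)) := X = set0 \/ (partial_hom X /\ G0 `<=` X).
have [|G [PG maxG]] := @Zorn_bigcup _ P.
  move=> F FP Ftot; case: (pselect (exists2 X, F X & X !=set0)); last first.
    move=> h; left; rewrite -subset0 => u [X FX Xu]; apply: h; exists X => //.
    by exists u.
  move=> [X FX [u Xu]]; right.
  have ne Y w : F Y -> Y w -> partial_hom Y /\ G0 `<=` Y.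
    by move=> FY Yw; have [Y0|//] := FP Y FY; rewrite Y0 in Yw.
  have two w w' : (\bigcup_(Y in F) Y) w -> (\bigcup_(Y in F) Y) w' ->
      exists2 Y, F Y & Y w /\ Y w'.
    move=> [Y FY Yw] [Z FZ Zw']; case: (Ftot _ _ FY FZ) => s.
      by exists Z => //; split => //; exact: s.
    by exists Y => //; split => //; exact: s.
  have [hX sX] := ne _ _ FX Xu.
  split; last by move=> w /sX; exists X.
  split.
  - by move=> c; exists X => //; exact: (phom_const hX).
  - move=> x y a b hx hy; have [Y FY [Yx Yy]] := two _ _ hx hy.
    by exists Y => //; have [hY _] := ne _ _ FY Yx; exact: (phomB hY).
  - move=> x y a b hx hy; have [Y FY [Yx Yy]] := two _ _ hx hy.
    by exists Y => //; have [hY _] := ne _ _ FY Yx; exact: (phomM hY).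
  - move=> a [Y FY Y0a]; have [hY _] := ne _ _ FY Y0a; exact: (phom_fun hY).
have [hG sG] : partial_hom G /\ G0 `<=` G.
  case: PG => // GE; exfalso; apply: (maxG G0); last first.
    by right; split => // w.
  rewrite GE; split; first by move=> w.
  by move=> /(_ _ (phom1 hG0)).
exists G; split => // x x0.
have ext y : ~ vanishing_reduction G y 1 -> exists a, G (y, a).
  move=> /(vanishing_reduction_root hG) [a ha]; exists a.
  apply: contrapT => nG; apply: (maxG (adjoin G y a)).
    split; first exact: (adjoin_sub hG).
    by move=> h; apply: nG; apply: h; exact: (adjoin_mem hG).
  right; split; first exact: adjoin_partial_hom.
  exact: subset_trans (adjoin_sub hG _ _).
case: (pselect (vanishing_reduction G x 1)) => [h|/ext]; last by left.
case: (pselect (vanishing_reduction G x^-1 1)) => [h'|/ext]; last by right.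
by case: (no_inverse_pole hG x0 h h').
Qed.

End Places.

(** * Growth of entire functions *)

Section GaussNorm.
Variables (K : closedFieldType) (R : realType) (v : nonarch_absval K R).
Implicit Types (f g h : entire v) (c : K) (r e : R).

Definition gauss r f : R := sup (range (weight v r f)).

Lemma gaussE r f i : 0 <= r -> (forall k, weight v r f k <= weight v r f i) ->
  gauss r f = weight v r f i.
Proof.
move=> r0 hi; apply/le_anti/andP; split.
  by apply: ge_sup; [exists (weight v r f 0%N), 0%N|move=> _ [k _ <-]].
apply: ub_le_sup; last by exists i.
by exists (weight v r f i) => _ [k _ <-].
Qed.

Lemma gauss_attained r f : 0 < r -> exists i, gauss r f = weight v r f i /\
  forall k, weight v r f k <= weight v r f i.
Proof.
move=> r0; have [i hi] : exists i, forall k, weight v r f k <= weight v r f i.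
  case: (eqVneq f 0) => [->|f0].
    by exists 0%N => k; rewrite /weight !coefs0 absv0 !mul0r.
  by have [i [hi _] _] := dominant_entire r0 f0; exists i.
by exists i; rewrite (gaussE (ltW r0) hi).
Qed.

Lemma weight_le_gauss r f k : 0 < r -> weight v r f k <= gauss r f.
Proof. by move=> /(gauss_attained f) [i [-> ]]. Qed.

Lemma gauss_ge0 r f : 0 < r -> 0 <= gauss r f.
Proof.
by move=> r0; apply: le_trans (weight_le_gauss f 0 r0); rewrite weight_ge0 ?ltW.
Qed.

Lemma gauss_gt0 r f : 0 < r -> f != 0 -> 0 < gauss r f.
Proof.
move=> r0 /entire_neq0P [k fk]; apply: lt_le_trans (weight_le_gauss f k r0).
by rewrite weight_gt0.
Qed.

Lemma gauss0 r : 0 < r -> gauss r (0 : entire v) = 0.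
Proof.
by move=> /(gauss_attained 0) [i [-> _]]; rewrite /weight coefs0 absv0 mul0r.
Qed.

Lemma gaussM r f g : 0 < r -> gauss r (f * g) = gauss r f * gauss r g.
Proof.
move=> r0; case: (eqVneq f 0) => [->|f0]; first by rewrite mul0r gauss0 ?mul0r.
case: (eqVneq g 0) => [->|g0]; first by rewrite mulr0 gauss0 ?mulr0.
have [i di wi] := dominant_entire r0 f0.
have [j dj wj] := dominant_entire r0 g0.
have [[d _] E] := dominant_conv r0 di dj wi wj.
rewrite (gaussE (ltW r0) di.1) (gaussE (ltW r0) dj.1) -E.
exact: (@gaussE r (f * g) _ (ltW r0) d).
Qed.

Lemma gaussB_le r f g B : 0 < r -> gauss r f <= B -> gauss r g <= B ->
  gauss r (f - g) <= B.
Proof.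
move=> r0 hf hg; have [i [-> _]] := gauss_attained (f - g) r0.
have rk : 0 <= r ^+ i by rewrite exprn_ge0 ?ltW.
rewrite /weight coefsB; apply: le_trans (ler_wpM2r rk (absvB_le v _ _)) _.
rewrite maxr_pMl // ge_max (le_trans _ hf) ?(le_trans _ hg) //;
  exact: weight_le_gauss.
Qed.

Lemma gauss_const r c : 0 < r -> gauss r (entire_const v c) = v c.
Proof.
move=> r0; have w0 : weight v r (entire_const v c) 0 = v c.
  by rewrite /weight /= mulr1n expr0 mulr1.
rewrite -[RHS]w0; apply: gaussE; rewrite ?ltW // w0 => -[|k]; rewrite ?w0 //.
by rewrite /weight /= mulr0n absv0 mul0r absv_ge0.
Qed.

(** [f = o(g)] for the Gauss norms, as the radius tends to infinity. *)
Definition small f g : Prop := forall e, 0 < e ->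
  exists2 r0, 0 < r0 & forall r, r0 <= r -> gauss r f <= e * gauss r g.

Lemma smallB f f' g : small f g -> small f' g -> small (f - f') g.
Proof.
move=> h h' e e0.
have [r0 r0_gt0 hr] := h e e0; have [r1 r1_gt0 hr'] := h' e e0.
exists (Num.max r0 r1); first by rewrite lt_max r0_gt0.
move=> r; rewrite ge_max => /andP [le0 le1].
by apply: gaussB_le; [exact: lt_le_trans le0|exact: hr|exact: hr'].
Qed.

Lemma small0 g : small 0 g.
Proof.
move=> e e0; exists 1 => // r r1; have r0 : 0 < r := lt_le_trans ltr01 r1.
by rewrite gauss0 // mulr_ge0 ?gauss_ge0 // ltW.
Qed.

Lemma smallN f g : small f g -> small (- f) g.
Proof. by move=> h; rewrite -sub0r; apply: smallB => //; exact: small0. Qed.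

Lemma smallD f f' g : small f g -> small f' g -> small (f + f') g.
Proof.
by move=> h h'; rewrite -[f']opprK; apply: smallB => //; exact: smallN.
Qed.

Lemma smallM f f' g g' : small f g -> small f' g' -> small (f * f') (g * g').
Proof.
move=> h h' e e0.
have [r0 r0_gt0 hr] := h e e0; have [r1 r1_gt0 hr'] := h' 1 ltr01.
exists (Num.max r0 r1); first by rewrite lt_max r0_gt0.
move=> r; rewrite ge_max => /andP [le0 le1].
have rgt0 : 0 < r by exact: lt_le_trans le0.
rewrite !gaussM // mulrA; apply: ler_pM; rewrite ?gauss_ge0 //; first exact: hr.
by have := hr' _ le1; rewrite mul1r.
Qed.

Lemma smallMr f g h : small f g -> small (f * h) (g * h).
Proof.
move=> hs e e0; have [r0 r0_gt0 hr] := hs e e0; exists r0 => // r le0.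
have rgt0 : 0 < r by exact: lt_le_trans le0.
by rewrite !gaussM // mulrA ler_wpM2r ?gauss_ge0 // hr.
Qed.

Lemma smallZ c f g : small f g -> small (entire_const v c * f) g.
Proof.
move=> hs e e0; have c1 : 0 < 1 + v c by rewrite ltr_wpDr ?absv_ge0.
have [r0 r0_gt0 hr] := hs _ (divr_gt0 e0 c1); exists r0 => // r le0.
have rgt0 : 0 < r by exact: lt_le_trans le0.
rewrite gaussM // gauss_const //.
apply: le_trans (_ : (1 + v c) * gauss r f <= _).
  by rewrite ler_wpM2r ?gauss_ge0 // lerDr.
by rewrite mulrC -ler_pdivlMr // mulrAC hr.
Qed.

Lemma small_multiple c g : g != 0 -> small (entire_const v c * g) g -> c = 0.
Proof.
move=> g0 h; apply/eqP; rewrite -(absv_neq0 v) eq_le absv_ge0 andbT.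
apply/ler_addgt0Pl => e /h [r r0 /(_ r (lexx r))].
by rewrite gaussM // gauss_const // ler_pM2r ?gauss_gt0 // addr0.
Qed.

Lemma small_const_nonconst c g k : (0 < k)%N -> g k != 0 ->
  small (entire_const v c) g.
Proof.
move=> k0 gk e e0; have vk : 0 < v (g k) by rewrite absv_gt0.
(* For r beyond this bound, e (v (g k)) r^k >= e (v (g k)) r >= v c. *)
exists (1 + v c / (e * v (g k))).
  by rewrite ltr_wpDr ?divr_ge0 ?absv_ge0 // mulr_ge0 ?absv_ge0 ?ltW.
move=> r hr; have ev : 0 < e * v (g k) by rewrite mulr_gt0.
have q0 : 0 <= v c / (e * v (g k)) by rewrite divr_ge0 ?absv_ge0 ?ltW.
have r1 : 1 <= r by lra.
have rgt0 : 0 < r by lra.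
rewrite gauss_const //.
apply: le_trans (_ : e * weight v r g k <= _); last first.
  by rewrite ler_pM2l // weight_le_gauss.
rewrite /weight mulrA; apply: le_trans (_ : e * v (g k) * r <= _).
  by rewrite mulrC -ler_pdivrMr //; lra.
by rewrite ler_pM2l // ler_eXnr.
Qed.

Notation "x %:F" := (tofrac x).

Definition iota : {rmorphism K -> {fraction entire v}} :=
  (@tofrac (entire v) \o @entire_const K R v)%FUN.

(** The graph of the limit as the radius tends to infinity, in the sense of
    the Gauss norms: [f / g] has limit [c] if [f - c g] is [o(g)]. *)
Definition limit_at_infinity : set ({fraction entire v} * K) :=
  [set u | exists f g, [/\ g != 0, u.1 = f%:F / g%:F &
    small (f - entire_const v u.2 * g) g]].

Lemma limit_partial_hom : partial_hom iota limit_at_infinity.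
Proof.
have F0 g : g != 0 -> g%:F != 0 by rewrite tofrac_eq0.
split.
- move=> c; exists (entire_const v c), 1; split; rewrite ?oner_eq0 //=.
    by rewrite tofrac1 divr1.
  by rewrite mulr1 subrr; exact: small0.
- move=> _ _ c c' [f [g [g0 /= -> h]]] [f' [g' [g0' /= -> h']]].
  exists (f * g' - f' * g), (g * g'); split => /=.
  + by rewrite mulf_neq0.
  + by rewrite tofracB !tofracM -mulNr addf_div ?F0 // mulNr.
  rewrite rmorphB /=.
  have -> : f * g' - f' * g -
      (entire_const v c - entire_const v c') * (g * g') =
    (f - entire_const v c * g) * g' - (f' - entire_const v c' * g') * g by ring.
  apply: smallB; first exact: smallMr.
  by rewrite [g * g']mulrC; exact: smallMr.
- move=> _ _ c c' [f [g [g0 /= -> h]]] [f' [g' [g0' /= -> h']]].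
  exists (f * f'), (g * g'); split => /=.
  + by rewrite mulf_neq0.
  + by rewrite !tofracM mulf_div.
  rewrite rmorphM /=.
  have -> : f * f' - entire_const v c * entire_const v c' * (g * g') =
    (f - entire_const v c * g) * (f' - entire_const v c' * g') +
    (entire_const v c' * ((f - entire_const v c * g) * g') +
     entire_const v c * ((f' - entire_const v c' * g') * g)) by ring.
  apply: smallD; first exact: smallM.
  apply: smallD; apply: smallZ; first exact: smallMr.
  by rewrite [g * g']mulrC; exact: smallMr.
- move=> c [f [g [g0 /= /esym/eqP]]].
  rewrite mulf_eq0 invr_eq0 (negPf (F0 _ g0)) orbF tofrac_eq0 => /eqP -> h.
  apply: (small_multiple g0).
  by have := smallN h; rewrite sub0r opprK.
Qed.

Lemma limit_pole g k :
  (0 < k)%N -> g k != 0 -> limit_at_infinity ((g%:F)^-1, 0).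
Proof.
move=> k0 gk; exists 1, g; split => /=.
- by apply: contraNneq gk => ->; rewrite coefs0.
- by rewrite tofrac1 div1r.
have -> : 1 - entire_const v 0 * g = entire_const v 1.
  by rewrite rmorph0 mul0r subr0 rmorph1.
exact: small_const_nonconst gk.
Qed.

End GaussNorm.

(** * Residues of vectors and of polynomial values *)

Section PlaceOnVectors.
Variables (K : closedFieldType) (L : fieldType) (iota : {rmorphism K -> L}).
Variables (G : set (L * K)) (hG : partial_hom iota G).
Hypothesis totalG : total_phom G.

Lemma phomX x a k : G (x, a) -> G (x ^+ k, a ^+ k).
Proof.
move=> h; elim: k => [|k IH]; first by rewrite !expr0; exact: (phom1 hG).
by rewrite !exprS; apply: (phomM hG).
Qed.

(** Dividing by the largest coordinate, in the sense of the place, makes the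
    residue of the vector defined and nonzero. *)
Lemma dominant_coordinate n (x : 'I_n -> L) : (exists j, x j != 0) ->
  exists2 i, x i != 0 & forall j, exists a, G (x j / x i, a).
Proof.
move=> [j0 xj0].
suff H (s : seq 'I_n) : (exists2 j, j \in s & x j != 0) ->
    exists2 i, x i != 0 & forall j, j \in s -> exists a, G (x j / x i, a).
  have [|i xi hi] := H (enum 'I_n); first by exists j0; rewrite ?mem_enum.
  by exists i => // j; apply: hi; rewrite mem_enum.
have self t : x t != 0 -> exists a, G (x t / x t, a).
  by move=> xt; exists 1; rewrite divff //; exact: (phom1 hG).
have zero t i : x t = 0 -> exists a, G (x t / x i, a).
  by move=> ->; exists 0; rewrite mul0r; exact: (phom0 hG).
elim: s => [[]//|t s IH] _.
case: (pselect (exists2 j, j \in s & x j != 0)) => [h|h]; last first.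
  have hz j : j \in s -> x j = 0.
    by move=> js; apply/eqP/negPn/negP => xj; apply: h; exists j.
  case: (eqVneq (x t) 0) => [xt|xt]; last first.
    exists t => // j; rewrite inE => /predU1P [->|/hz].
      exact: self.
    exact: zero.
  exists j0 => // j; rewrite inE => /predU1P [->|/hz]; exact: zero.
have {h} [i xi hi] := IH h.
case: (eqVneq (x t) 0) => [xt|xt].
  exists i => // j; rewrite inE => /predU1P [->|/hi //]; exact: zero.
have txi : x t / x i != 0 by rewrite mulf_neq0 ?invr_eq0.
case: (totalG txi) => [h|[a ha]].
  by exists i => // j; rewrite inE => /predU1P [->//|/hi].
exists t => // j; rewrite inE => /predU1P [->|/hi [b hb]]; first exact: self.
exists (b * a).
have -> : x j / x t = x j / x i * (x t / x i)^-1 by field; rewrite xi xt.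
exact: (phomM hG).
Qed.

Lemma phom_mmap n (P : mpoly n K) (y : 'I_n -> L) (p : 'I_n -> K) :
  (forall j, G (y j, p j)) -> G (mmap iota y P, meval p P).
Proof.
move=> h; move: P; apply: mpoly_subalgebra_ind => [c|j|P Q hP hQ|P Q hP hQ].
- by rewrite mmapC mevalC; exact: (phom_const hG).
- by rewrite mmapX mmap1U mevalXU.
- by rewrite mmapD mevalD; exact: (phomD hG).
- by rewrite mmapM mevalM; exact: (phomM hG).
Qed.

(** First-order Taylor expansion at a point with coordinates in [K]: as [eps]
    has value 0, the terms of higher order contribute to [w] but not to its
    value.  Sums and products preserve this property. *)
Lemma phom_expansion n (P : mpoly n K) (p hb : 'I_n -> K) (h : 'I_n -> L) eps :
  G (eps, 0) -> (forall j, G (h j, hb j)) ->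
  exists2 w, G (w, \sum_j meval p (mderiv j P) * hb j) &
    mmap iota (fun j => iota (p j) + eps * h j) P = iota (meval p P) + eps * w.
Proof.
move=> heps hh; move: P.
apply: mpoly_subalgebra_ind =>
  [c|i|P Q [w hw Ew] [w' hw' Ew']|P Q [w hw Ew] [w' hw' Ew']].
- exists 0; last by rewrite mmapC mevalC mulr0 addr0.
  rewrite big1 => [|j _]; first exact: (phom0 hG).
  by rewrite mderivC meval0 mul0r.
- exists (h i); last by rewrite mmapX mmap1U mevalXU.
  rewrite (bigD1 i) //= big1 => [|j ji].
    rewrite mderivX mnmE eqxx scale1r addr0 mevalX big1 ?mul1r // => k _.
    by rewrite mnmE mnmE subnn expr0.
  by rewrite mderivX mnmE eq_sym (negPf ji) scale0r meval0 mul0r.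
- exists (w + w'); last by rewrite mmapD mevalD Ew Ew' rmorphD; ring.
  have -> : \sum_j meval p (mderiv j (P + Q)) * hb j =
    \sum_j meval p (mderiv j P) * hb j + \sum_j meval p (mderiv j Q) * hb j.
    by rewrite -big_split; apply: eq_bigr => j _; rewrite mderivD mevalD mulrDl.
  exact: (phomD hG).
- exists (iota (meval p P) * w' + iota (meval p Q) * w + eps * (w * w')).
    have -> : \sum_j meval p (mderiv j (P * Q)) * hb j =
      meval p P * (\sum_j meval p (mderiv j Q) * hb j) +
      meval p Q * (\sum_j meval p (mderiv j P) * hb j) +
      0 * ((\sum_j meval p (mderiv j P) * hb j) *
           (\sum_j meval p (mderiv j Q) * hb j)).
      rewrite mul0r addr0 !mulr_sumr -big_split; apply: eq_bigr => j _ /=.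
      by rewrite mderivM mevalD !mevalM; ring.
    apply: (phomD hG); first apply: (phomD hG).
    + by apply: (phomM hG) => //; exact: (phom_const hG).
    + by apply: (phomM hG) => //; exact: (phom_const hG).
    + by apply: (phomM hG) => //; exact: (phomM hG).
  by rewrite mmapM mevalM Ew Ew' rmorphM; ring.
Qed.

End PlaceOnVectors.

(** * Points of projective space *)

Section ProjectivePoints.
Variables (K : fieldType) (n : nat).

Lemma line_dim (u : 'rV[K]_n.+1) : u != 0 -> \dim <[u]>%VS == 1%N.
Proof. by move=> u0; rewrite dim_vline u0. Qed.

Lemma coords_line (x : proj K n) (u : 'I_n.+1 -> K) :
  val x = <[\row_j u j]>%VS ->
  exists2 l, l != 0 & forall j, coords x j = l * u j.
Proof.
move=> E; have : vpick (val x) \in <[\row_j u j]>%VS by rewrite -E memv_pick.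
move=> /vlineP [l El]; exists l; last by move=> j; rewrite /coords El !mxE.
apply/eqP => l0; have : vpick (val x) == 0 by rewrite El l0 scale0r.
rewrite vpick0 => /eqP x0; have := valP x; rewrite /= x0 dimv0 //.
Qed.

Lemma proj_point (u : 'I_n.+1 -> K) j : u j != 0 ->
  exists x : proj K n, val x = <[\row_j u j]>%VS.
Proof.
move=> uj; have u0 : \row_j u j != 0.
  by apply: contraNneq uj => /rowP /(_ j); rewrite !mxE => ->.
pose is_line (U : {vspace 'rV[K]_n.+1}) := \dim U == 1%N.
by exists (exist is_line _ (line_dim u0)).
Qed.

End ProjectivePoints.

Lemma proj0_unique (K : fieldType) (x y : proj K 0) : x = y.
Proof.
have full (z : proj K 0) : val z = fullv.
  apply/eqP; rewrite eqEdim subvf dimvf (eqP (valP z)).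
  by rewrite /dim /= mul1n.
by apply: val_inj; rewrite !full.
Qed.

(** * Expansion at infinity *)


Section PolesAtInfinity.
Variables (K : closedFieldType) (L : fieldType) (iota : {rmorphism K -> L}).
Variables (G : set (L * K)) (hG : partial_hom iota G).
Hypothesis totalG : total_phom G.
(* [A] stands for the ring of entire functions. *)
Variable A : set L.
Hypothesis A_const : forall c, A (iota c).
Hypothesis AB : forall f g, A f -> A g -> A (f - g).
Hypothesis AM : forall f g, A f -> A g -> A (f * g).
Hypothesis A_pole : forall f, A f -> (exists c, f = iota c) \/ G (f^-1, 0).

Lemma place_finite_pole f a : f != 0 -> G (f, a) -> G (f^-1, 0) -> False.
Proof.
move=> f0 ha /(phomM hG ha); rewrite divff // mulr0 => h.
by have /eqP := phom_inj hG (phom1 hG) h; rewrite oner_eq0.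
Qed.

(** Otherwise [f * g] is a constant, [g] has value 0 at the place, and no
    nonzero element of [A] does. *)
Lemma pole_mul f g : A f -> G (f^-1, 0) -> A g -> g != 0 -> G ((f * g)^-1, 0).
Proof.
move=> Af hf Ag g0; case: (A_pole (AM Af Ag)) => // -[c Ec].
case: (eqVneq f 0) => [f0|f0]; first by move: hf; rewrite f0 mul0r.
have gE : g = iota c * f^-1 by rewrite -Ec mulrAC divff // mul1r.
have hg : G (g, 0).
  by have := phomM hG (phom_const hG c) hf; rewrite -gE mulr0.
case: (A_pole Ag) => [[b Eb]|/(place_finite_pole g0 hg)//].
have b0 : b = 0.
  by apply: (phom_inj hG (x := g)) => //; rewrite Eb; exact: phom_const hG _.
by move: g0; rewrite Eb b0 rmorph0 eqxx.
Qed.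

Lemma A_exp f k : A f -> A (f ^+ k).
Proof.
move=> Af; elim: k => [|k IH]; first by rewrite expr0 -(rmorph1 iota).
by rewrite exprS; apply: AM.
Qed.

Section Hypersurfaces.
Variables (n : nat) (D : 'I_n -> hypersurface K n) (c : 'I_n -> K).
Hypothesis n_gt0 : (0 < n)%N.
Hypothesis transversal_D : intersect_transversally D.
Hypothesis deg_D : forall i, (2 <= hdeg (D i))%N.
Variable x : 'I_n.+1 -> L.
Hypothesis Ax : forall j, A (x j).
Hypothesis c_neq0 : forall i, c i != 0.
Hypothesis DxE : forall i, mmap iota x (hform (D i)) = iota (c i).

(** [pt] is the residue of [x] divided by its largest coordinate [x i0].  The
    scaling of [X] makes the residues of [x j / X] equal to the chosen
    coordinates of [pt], not merely proportional to them.
    [X] is a pole because a constant [x i0] would dominate the nonconstant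
    coordinate, whose value is infinite. *)
Lemma center_at_infinity : (exists j, ~ exists a, x j = iota a) ->
  exists (pt : proj K n) (X : L) i0,
    [/\ A X, X != 0 & G (X^-1, 0)] /\
    [/\ x i0 = iota (coords pt i0) * X, coords pt i0 != 0 &
        forall j, G (x j / X, coords pt j)].
Proof.
move=> [j0 ncj0].
have xj0 : x j0 != 0.
  by apply/eqP => E; apply: ncj0; exists 0; rewrite rmorph0.
have [i0 xi0 hi0] := dominant_coordinate hG totalG (ex_intro _ j0 xj0).
have polei0 : G ((x i0)^-1, 0).
  case: (A_pole (Ax i0)) => // -[b Eb].
  have polej0 : G ((x j0)^-1, 0) by case: (A_pole (Ax j0)).
  have [a ha] := hi0 j0.
  have := phomM hG ha polej0; rewrite mulr0 mulrAC divff // mul1r Eb -fmorphV.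
  by [].
have [a ha] := choice hi0.
have ai0 : a i0 = 1.
  by apply: (phom_inj hG (ha i0)); rewrite divff //; exact: phom1 hG.
have [pt Ept] : exists x : proj K n, val x = <[\row_j a j]>%VS.
  by apply: (@proj_point _ _ _ i0); rewrite ai0 oner_eq0.
have [l l0 hl] := coords_line Ept.
have il0 : iota l != 0 by rewrite fmorph_eq0.
exists pt, (iota l^-1 * x i0), i0; rewrite !hl ai0 mulr1 fmorphV.
split; split=> //.
- by apply: AM => //; rewrite -fmorphV.
- by rewrite mulf_neq0 ?invr_eq0.
- rewrite invfM invrK; have := phomM hG (phom_const hG l) polei0.
  by rewrite mulr0.
- by rewrite mulrA divff // mul1r.
- move=> j; rewrite hl; have := phomM hG (phom_const hG l) (ha j).
  by rewrite invfM invrK [iota l * (_ / _)]mulrCA mulrCA.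
Qed.

(** With the notation of the proof, [x = X p + H] and
    [x / X = p + eps (H / H j1)].  Comparing the two expressions of the
    equation at [x / X] gives [eps w = c X^-d], where [w] has value
    grad . hb; so [w = c / (X^(d-1) H j1)], which has value 0 because
    [X^(d-1) H j1] is a nonconstant element of [A] when [d >= 2]. *)
Lemma coordinates_constant j : exists a, x j = iota a.
Proof.
apply: contrapT => ncj.
have [pt [X [i0 [[AX X0 poleX] [xi0 pi0 hy]]]]] :=
  center_at_infinity (ex_intro _ j ncj).
set p := coords pt in xi0 pi0 hy.
pose y j := x j / X.
have DyE i : mmap iota y (hform (D i)) = iota (c i) * X^-1 ^+ hdeg (D i).
  have := mmap_homog iota (fun j => y j) X (hform_homog (D i)).
  have -> : (fun j => X * y j) = x.
    by apply/funext => k; rewrite /y mulrCA divff // mulr1.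
  rewrite DxE => ->; rewrite exprVn mulrAC divff ?mul1r //.
  by rewrite expf_neq0.
have Dp i : meval p (hform (D i)) = 0.
  apply: (phom_inj hG (phom_mmap hG (hform (D i)) hy)).
  have := phomM hG (phom_const hG (c i)) (phomX hG (hdeg (D i)) poleX).
  by rewrite DyE expr0n gtn_eqF ?hdeg_gt0 // mulr0.
pose H j := x j - iota (p j) * X.
have AH k : A (H k) by apply: AB => //; apply: AM.
case: (pselect (exists k, H k != 0)) => [exH|H0]; last first.
  (* [x] is proportional to [p], so all the equations would vanish on it. *)
  have xE : x = (fun k => X * iota (p k)).
    apply/funext => k; apply/eqP; rewrite -subr_eq0 [X * _]mulrC -/(H k).
    by apply/negPn/negP => h; apply: H0; exists k.
  have := DxE (Ordinal n_gt0); rewrite xE (mmap_homog _ _ _ (hform_homog _)).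
  have := rmorph_mmap idfun iota p (hform (D (Ordinal n_gt0))).
  rewrite -/(meval _ _) Dp rmorph0 => <-; rewrite mulr0 => /esym/eqP.
  by rewrite fmorph_eq0 (negPf (c_neq0 _)).
have [j1 Hj1 hH] := dominant_coordinate hG totalG exH.
have [hb hhb] := choice hH.
pose eps := H j1 / X.
have epsE : G (eps, 0).
  have := phomB hG (hy j1) (phom_const hG (p j1)); rewrite subrr.
  by rewrite /eps /H mulrBl mulfK.
have grad i : \sum_j meval p (mderiv j (hform (D i))) * hb j = 0.
  have [w hw] := phom_expansion hG (hform (D i)) p epsE hhb.
  have -> : (fun k => iota (p k) + eps * (H k / H j1)) = y.
    apply/funext => k; rewrite /eps /y /H; move: Hj1; rewrite /H => Hj1.
    by field; rewrite X0 Hj1.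
  rewrite DyE Dp rmorph0 add0r => Ew.
  apply: (phom_inj hG hw).
  pose d := (hdeg (D i)).-2.
  have dE : hdeg (D i) = d.+2.
    by have := deg_D i; rewrite /d; case: (hdeg _) => [|[]].
  have -> : w = iota (c i) * (X * (X ^+ d * H j1))^-1.
    have eps0 : eps != 0 by rewrite mulf_neq0 ?invr_eq0.
    apply: (mulfI eps0); rewrite -Ew dE exprVn !exprS /eps; field.
    by rewrite Hj1 X0 expf_neq0.
  have := phomM hG (phom_const hG (c i)) (_ : G ((X * (X ^+ d * H j1))^-1, 0)).
  rewrite mulr0; apply; apply: pole_mul => //.
    by apply: AM => //; exact: A_exp.
  by rewrite mulf_neq0 ?expf_neq0.
(* [hb] is tangent to every [D i] but not proportional to [p], by its
   coordinates [j1] and [i0]. *)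
have hbj1 : hb j1 = 1.
  by apply: (phom_inj hG (hhb j1)); rewrite divff //; exact: phom1 hG.
have hbi0 : hb i0 = 0.
  apply: (phom_inj hG (hhb i0)); rewrite /H xi0 subrr mul0r; exact: phom0 hG.
have [q Eq] : exists q : proj K n, val q = <[\row_j hb j]>%VS.
  by apply: (@proj_point _ _ _ j1); rewrite hbj1 oner_eq0.
have [m m0 hq] := coords_line Eq.
have : (\bigcap_i tangent_space (D i) pt) q.
  move=> i _; rewrite /tangent_space /=.
  transitivity (m * \sum_k meval p (mderiv k (hform (D i))) * hb k).
    by rewrite mulr_sumr; apply: eq_bigr => k _; rewrite hq mulrCA.
  by rewrite grad mulr0.
rewrite (transversal_D (x := pt)); last by move=> i _; exact: Dp.
by move=> E; move: pi0; rewrite /p -E hq hbi0 mulr0 eqxx.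
Qed.

End Hypersurfaces.
End PolesAtInfinity.

(** * Hyperbolicity *)

Section EntireMaps.
Variables (K : closedFieldType) (R : realType) (v : nonarch_absval K R).
Hypothesis complete_v : absv_complete v.

Lemma entire_eq_const (f : entire v) :
  (forall k, (0 < k)%N -> f k = 0) -> f = entire_const v (f 0%N).
Proof.
move=> h; apply/entire_eq/funext => -[|k] /=; first by rewrite mulr1n.
by rewrite mulr0n h.
Qed.

Lemma zero_free_const (f : entire v) :
  (forall z, ~ evalto v f z 0) -> exists c, f = entire_const v c.
Proof.
move=> h; exists (f 0%N); apply: entire_eq_const => k k0.
apply/eqP/negPn/negP => fk.
by have [z /h] := entire_zero complete_v (entireE f) k0 fk.
Qed.

Lemma entire_solution_const n (D : 'I_n -> hypersurface K n) (c : 'I_n -> K)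
    (F : 'I_n.+1 -> entire v) :
  (0 < n)%N -> intersect_transversally D -> (forall i, (2 <= hdeg (D i))%N) ->
  (forall i, c i != 0) ->
  (forall i,
    mmap (@entire_const K R v) F (hform (D i)) = entire_const v (c i)) ->
  forall j, exists b, F j = entire_const v b.
Proof.
move=> n0 tD dD c0 DF j.
have [G [hG sG tG]] := place_extension (limit_partial_hom v).
pose A := range (@tofrac (entire v)).
have [] := @coordinates_constant _ _ _ G hG tG A _ _ _ _ n D c n0 tD dD
  (fun k => tofrac (F k)) _ c0 _ j.
- by move=> b; exists (entire_const v b).
- by move=> _ _ [f _ <-] [g _ <-]; exists (f - g); rewrite ?tofracB.
- by move=> _ _ [f _ <-] [g _ <-]; exists (f * g); rewrite ?tofracM.
- move=> _ [f _ <-]; case: (pselect (exists2 k, (0 < k)%N & f k != 0)).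
    by move=> [k k0 fk]; right; apply: sG; exact: limit_pole fk.
  move=> h; left; exists (f 0%N); rewrite {1}[f]entire_eq_const // => k k0.
  by apply/eqP/negPn/negP => fk; apply: h; exists k.
- by move=> k; exists (F k).
- move=> i.
  have := rmorph_mmap (@entire_const K R v) (@tofrac (entire v)) F
    (hform (D i)).
  by rewrite DF => <-.
move=> b /eqP; rewrite tofrac_eq => /eqP ->; by exists b.
Qed.

End EntireMaps.

Theorem theorem3 (K : closedFieldType) (R : realType)
    (v : nonarch_absval K R) (complete_v : absv_complete v)
    (n : nat) (D : 'I_n -> hypersurface K n)
    (nonsingular_D : forall i, nonsingular (D i))
    (transversal_D : intersect_transversally D)
    (deg_D : forall i, (2 <= hdeg (D i))%N) :
  hyperbolic v (~` \bigcup_i hpoints (D i))%classic.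
Proof.
case: n D nonsingular_D transversal_D deg_D =>
    [|n] D _ tD dD f [F [anF _ fE]] fY z w.
  exact: proj0_unique.
have [a ha] := choice anF.
have ea j : entire_coefs v (a j).
  by apply: analytic_entire => x; exists (F j x); exact: ha.
pose E j := Entire (asboolT (ea j)).
have evE j x : evalto v (E j) x (F j x) by exact: ha.
pose T i := mmap (@entire_const K R v) E (hform (D i)).
have evT i x : evalto v (T i) x (meval (fun j => F j x) (hform (D i))).
  exact: evalto_mmap (fun j => evE j x).
have DF0 i x : meval (fun j => F j x) (hform (D i)) != 0.
  apply/eqP => DF; apply: (fY x); exists i => //.
  have [l _ hl] := coords_line (fE x).
  rewrite /hpoints /= (meval_eq _ hl).
  have -> : meval (fun j => l * F j x) (hform (D i)) =
      l ^+ hdeg (D i) * meval (fun j => F j x) (hform (D i)).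
    exact: (mmap_homog idfun _ _ (hform_homog (D i))).
  by rewrite DF mulr0.
have [c hc] := choice (fun i => zero_free_const complete_v (fun x h =>
  elimN eqP (DF0 i x) (absv_cvg_uniq (evT i x) h))).
have c0 i : c i != 0.
  have h : evalto v (T i) 0 (c i) by rewrite hc; exact: evalto_const.
  by rewrite -(absv_cvg_uniq (evT i 0) h).
have /choice [b hb] := entire_solution_const (ltn0Sn n) tD dD c0 hc.
have Fb j x : F j x = b j.
  apply: absv_cvg_uniq (evE j x) _.
  by have := evalto_const v (b j) x; rewrite hb.
apply: val_inj; rewrite /= !fE; congr (<[_]>%VS).
by apply/rowP => j; rewrite !mxE !Fb.
Qed.
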